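(* There is a deterministic algorithm which, given $n$, $\delta$ with $0<\delta<1$, a vector $\mathbf{c}\in\mathbb{Q}_{\ge0}^n$ and $r\in\mathbb{Q}$ with $0<r\le 1$ and $\|\mathbf{c}\|_1\le r$, outputs a value $Z$ satisfying $$\mathrm{Vol}(C(\mathbf{0},1)\cap C(\mathbf{c},r))\le Z\le(1+\delta)\,\mathrm{Vol}(C(\mathbf{0},1)\cap C(\mathbf{c},r))$$ and runs in $O(n^7\delta^{-3})$ time.
   Context: For $\mathbf{c}\in\mathbb{R}^n$, $r\ge 0$, $C(\mathbf{c},r)=\{\mathbf{x}\in\mathbb{R}^n:\|\mathbf{x}-\mathbf{c}\|_1\le r\}$ (a cross-polytope, i.e. $L_1$-ball). *)

(* Defs.v *)
From HB Require Import structures.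
From mathcomp Require Import all_boot all_order all_algebra.
From mathcomp Require Import all_classical all_reals all_analysis.
Set Implicit Arguments. Unset Strict Implicit. Unset Printing Implicit Defensive.
Import Order.TTheory GRing.Theory Num.Theory.
Local Open Scope ring_scope.

(* Model of computation: a deterministic unit-cost RAM over the        *)
(* rationals.  Registers are indexed by nat and hold rationals; every   *)
(* instruction costs one time step.                                     *)

Inductive instr :=
  | IConst of nat & rat
  | IAdd of nat & nat & nat
  | ISub of nat & nat & nat
  | IMul of nat & nat & nat
  | IDiv of nat & nat & nat    (* R[i] := R[j] / R[k]   (x/0 = 0)    *)
  | ILoad of nat & nat
  | IStore of nat & nat
  | IJle of nat & nat & nat
  | IHalt.

Definition program := seq instr.

Record ram_state := RamState { pc : nat; regs : nat -> rat }.

(* indirect address: a register holding a non-negative integer m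
   addresses register m; any other value addresses register 0 *)
Definition addr (x : rat) : nat :=
  if (denq x == 1%Z) && (0 <= numq x)%R then `|numq x|%N else 0%N.

Definition upd (f : nat -> rat) (i : nat) (v : rat) : nat -> rat :=
  fun j => if j == i then v else f j.

Definition cur_instr (p : program) (s : ram_state) : instr :=
  nth IHalt p (pc s).

(* a state is halted when the current instruction is IHalt
   (this includes a program counter beyond the end of the program) *)
Definition halted (p : program) (s : ram_state) : bool :=
  if cur_instr p s is IHalt then true else false.

Definition step (p : program) (s : ram_state) : ram_state :=
  let R := regs s in
  let nxt := (pc s).+1 in
  match cur_instr p s with
  | IConst i q => RamState nxt (upd R i q)
  | IAdd i j k => RamState nxt (upd R i (R j + R k))
  | ISub i j k => RamState nxt (upd R i (R j - R k))
  | IMul i j k => RamState nxt (upd R i (R j * R k))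
  | IDiv i j k => RamState nxt (upd R i (R j / R k))
  | ILoad i j => RamState nxt (upd R i (R (addr (R j))))
  | IStore i j => RamState nxt (upd R (addr (R i)) (R j))
  | IJle i j l => if R i <= R j then RamState l R else RamState nxt R
  | IHalt => s
  end.

Definition run (p : program) (k : nat) (s : ram_state) : ram_state :=
  iter k (step p) s.

Definition init_state (n : nat) (delta r : rat) (c : n.-tuple rat) : ram_state :=
  RamState 0 (fun j =>
    if j == 0%N then n%:R
    else if j == 1%N then delta
    else if j == 2%N then r
    else if (3 <= j < n + 3)%N then nth 0 c (j - 3) else 0).

Definition output (s : ram_state) : rat := regs s 0.

(* n-dimensional volume, as the iterated Lebesgue integral of the      *)
(* indicator function (points of R^n are sequences of length n).        *)
(* For Borel sets (in particular the compact convex sets used here)     *)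
(* this is the n-dimensional Lebesgue measure, by Tonelli.              *)

Local Open Scope classical_set_scope.

Fixpoint vol {R : realType} (n : nat) (A : set (seq R)) : \bar R :=
  match n with
  | 0 => if `[< A [::] >] then 1%E else 0%E
  | m.+1 => (\int[@lebesgue_measure R]_x vol m [set s | A (x :: s)])%E
  end.

Definition cross {R : realType} (n : nat) (c : seq R) (r : R) : set (seq R) :=
  [set x | size x = n /\ \sum_(i < n) `|nth 0 x i - nth 0 c i| <= r].

Arguments init_state n delta r c : clear implicits.

(* Main.v *)
Require Import Defs.
From HB Require Import structures.
From mathcomp Require Import all_boot all_order all_algebra.
From mathcomp Require Import all_classical all_reals all_analysis.
From mathcomp Require Import measurable_realfun.
From mathcomp Require Import zify ring lra.
Import Order.TTheory GRing.Theory Num.Theory.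
Local Open Scope ring_scope.
Set Implicit Arguments. Unset Strict Implicit. Unset Printing Implicit Defensive.

(** Write [F cs u v] for the volume of the intersection of the [L_1]-balls of
    radius [u] around [0] and of radius [v] around [cs]; it satisfies
    [F (c :: cs) u v = int_x F cs (u - |x|) (v - |x - c|)].  Replacing the
    integral by a sum over a grid of mesh [h = r / L], with radii counted in
    multiples of [h], gives a dynamic program [cnt] with [O(L^2)] states per
    coordinate and [O(L)] terms per state, hence [O(n L^3)] operations.
    Enlarging the radii by [O(n h)] makes [h ^ n * cnt] an upper bound for the
    volume.  Conversely, the point [c / 2] lies at depth at least [r / 2] in
    both balls, so contracting towards it by the factor [1 + t] with
    [t = delta / (2 n)] gains [t r / 2] in both radii and absorbs the
    enlargement as soon as [L >= 16 n^2 / delta]; the price is the factor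
    [(1 + t) ^ n <= 1 + delta].  With this [L] the time is
    [O(n^7 / delta^3)]. *)

(** * Comparison of integrals with sums over cells *)

Section Step.
Context {R : realType}.
Implicit Types (f g : R -> \bar R) (p h x : R) (M : nat).
Local Notation mu := (@lebesgue_measure R).
Local Open Scope classical_set_scope.

(** The integral of a non-negative function is a supremum over the simple functions below it, and a
    larger function has more of these. Slice volumes can thus be compared without a proof that they
    are measurable in [x]. *)
Lemma ge0_le_integral_nomeas f g :
  (forall x, 0 <= f x)%E -> (forall x, f x <= g x)%E ->
  (\int[mu]_x f x <= \int[mu]_x g x)%E.
Proof.
move=> f0 fg; rewrite !ge0_integralTE//; last first.
  by move=> x; exact: le_trans (f0 x) (fg x).
apply: ereal_sup_le => _ [s /= sf <-]; exists s => //= x.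
exact: le_trans (sf x) (fg x).
Qed.

(** Half-open, so that the cells are pairwise disjoint and tile an interval: a step function takes
    exactly one of its values at each covered point. *)
Definition cell p h (j : nat) : set R := `[p + j%:R * h, p + j.+1%:R * h[.

Definition stepfun p h M (y : 'I_M -> R) x : R :=
  \sum_(j < M) y j * \1_(cell p h j) x.

Lemma cellP p h j x : cell p h j x <-> p + j%:R * h <= x < p + j.+1%:R * h.
Proof. by rewrite /cell /= in_itv. Qed.

Lemma measurable_cell p h j : measurable (cell p h j : set (measurableTypeR R)).
Proof. exact: measurable_itv. Qed.

Lemma lebesgue_measure_cell p h j : 0 < h -> mu (cell p h j) = h%:E.
Proof.
move=> h0; rewrite /cell lebesgue_measure_itv/= lte_fin ltrD2l ltr_pM2r//.
by rewrite ltr_nat ltnSn -EFinB -natr1; congr (_%:E); ring.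
Qed.

Lemma cell_inj p h i j x : 0 < h -> cell p h i x -> cell p h j x -> i = j.
Proof.
move=> h0 /cellP/andP[i1 i2] /cellP/andP[j1 j2].
have key a b : p + a%:R * h <= x -> x < p + b.+1%:R * h -> (a <= b)%N.
  move=> ha hb; have := le_lt_trans ha hb.
  by rewrite ltrD2l ltr_pM2r// ltr_nat ltnS.
by apply/eqP; rewrite eqn_leq !key.
Qed.

Lemma stepfun_in p h M (y : 'I_M -> R) x (j : 'I_M) :
  0 < h -> cell p h j x -> stepfun p h y x = y j.
Proof.
move=> h0 xj; rewrite /stepfun (bigD1 j)//= indicE mem_set// mulr1.
rewrite big1 ?addr0// => i ij; rewrite indicE memNset ?mulr0// => xi.
by move/negP: ij; apply; apply/eqP/val_inj/(cell_inj h0 xi xj).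
Qed.

Lemma stepfun_out p h M (y : 'I_M -> R) x :
  (forall j : 'I_M, ~ cell p h j x) -> stepfun p h y x = 0.
Proof. by move=> xj; apply: big1 => i _; rewrite indicE memNset ?mulr0. Qed.

Lemma integral_stepfun p h M (y : 'I_M -> R) : 0 < h -> (forall j, 0 <= y j) ->
  (\int[mu]_x (stepfun p h y x)%:E = (h * \sum_(j < M) y j)%:E)%E.
Proof.
move=> h0 y0; under eq_integral do rewrite -sumEFin.
rewrite ge0_integral_sum//=; last 2 first.
- move=> j; apply/measurable_EFinP/measurable_funM; first exact: measurable_cst.
  apply: measurable_indic; exact: measurable_cell.
- by move=> j x _; rewrite lee_fin mulr_ge0.
rewrite mulr_sumr -sumEFin; apply: eq_bigr => j _.
under eq_integral do rewrite EFinM.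
rewrite ge0_integralZl//; last 2 first.
- by apply/measurable_EFinP; apply: measurable_indic; exact: measurable_cell.
- by rewrite lee_fin.
rewrite integral_indic//; last exact: measurable_cell.
by rewrite setIT /= lebesgue_measure_cell// -EFinM mulrC.
Qed.

Lemma integral_le_cells p h M f (y : 'I_M -> R) :
  0 < h -> (forall j, 0 <= y j) -> (forall x, 0 <= f x)%E ->
  (forall x (j : 'I_M), cell p h j x -> f x <= (y j)%:E)%E ->
  (forall x, (forall j : 'I_M, ~ cell p h j x) -> f x = 0%E) ->
  (\int[mu]_x f x <= (h * \sum_(j < M) y j)%:E)%E.
Proof.
move=> h0 y0 f0 fy fo; rewrite -(integral_stepfun p)//.
apply: ge0_le_integral_nomeas => // x.
have [[j xj]|nj] := pselect (exists j : 'I_M, cell p h j x).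
  by rewrite (stepfun_in _ h0 xj) fy.
by rewrite fo ?stepfun_out// => j xj; apply: nj; exists j.
Qed.

Lemma cells_le_integral p h M f (y : 'I_M -> R) :
  0 < h -> (forall j, 0 <= y j) -> (forall x, 0 <= f x)%E ->
  (forall x (j : 'I_M), cell p h j x -> (y j)%:E <= f x)%E ->
  ((h * \sum_(j < M) y j)%:E <= \int[mu]_x f x)%E.
Proof.
move=> h0 y0 f0 fy; rewrite -(integral_stepfun p)//.
apply: ge0_le_integral_nomeas => // x.
  by rewrite lee_fin; apply: sumr_ge0 => j _; rewrite mulr_ge0.
have [[j xj]|nj] := pselect (exists j : 'I_M, cell p h j x).
  by rewrite (stepfun_in _ h0 xj) fy.
by rewrite stepfun_out// => j xj; apply: nj; exists j.
Qed.

End Step.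

(** * The volume and its discretisation *)

(** At least one of the two truncated differences vanishes, which leaves [|a - b|]. *)
Definition dist (a b : nat) : nat := (a - b + (b - a))%N.

Lemma natr_dist (F : realDomainType) (a b : nat) :
  (dist a b)%:R = `|a%:R - b%:R| :> F.
Proof.
rewrite /dist natrD; have [ab|ba] := leqP a b.
  have -> : (a - b = 0)%N by lia.
  by rewrite add0r natrB// distrC ger0_norm// subr_ge0 ler_nat.
have -> : (b - a = 0)%N by lia.
by rewrite addr0 natrB 1?ltnW// ger0_norm// subr_ge0 ler_nat ltnW.
Qed.

(** Index [j] stands for the cell starting at [(j - D) h], the shift by [D] keeping indices natural;
    [k] stands for the centre coordinate [k h]. The empty list yields 1 for all radii, since
    negative radii are already excluded by the tests. *)
Fixpoint cnt (D : nat) (ks : seq nat) (u w : nat) : nat :=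
  if ks is k :: ks' then
    \sum_(j < D.*2.+1)
      if (dist j D <= u)%N && (dist j (D + k) <= w)%N
      then cnt D ks' (u - dist j D) (w - dist j (D + k)) else 0
  else 1.

Section Volume.
Context {R : realType}.
Local Notation mu := (@lebesgue_measure R).
Local Open Scope classical_set_scope.

Fixpoint cvol (cs : seq R) (u v : R) : \bar R :=
  if cs is c :: cs' then (\int[mu]_x cvol cs' (u - `|x|)%R (v - `|x - c|)%R)%E
  else ((0 <= u) && (0 <= v))%:R%:E.

(** Fixing the first coordinate moves its contribution to the right of both norm inequalities, so a
    slice is again an intersection of two balls with smaller radii. *)
Lemma vol_cross (cs : seq R) (u v : R) :
  vol (size cs) (cross (size cs) (nseq (size cs) 0) u `&` cross (size cs) cs v)
  = cvol cs u v.
Proof.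
elim: cs u v => [|c cs IH] u v /=.
  rewrite /cross /= !big_ord0; case: asboolP => [[[_ ->] [_ ->]]//|/= nA].
  by case: (boolP (0 <= u)) => //= u0; case: (boolP (0 <= v)) => // v0; case: nA.
apply: eq_integral => x _; rewrite -IH; congr (vol _ _).
apply/seteqP; split=> s /=; rewrite /cross /= !big_ord_recl /= subr0.
  by move=> [[[-> h1] [_ h2]]]; split; split=> //; rewrite lerBrDl.
by move=> [[-> h1] [_ h2]]; split; split=> //; rewrite -lerBrDl.
Qed.

Lemma cvol_ge0 cs u v : (0 <= cvol cs u v)%E.
Proof.
case: cs => [|c cs] /=; first by rewrite lee_fin ler0n.
elim: cs c u v => [|c' cs IH] c u v; apply: integral_ge0 => x _ /=.
  by rewrite lee_fin ler0n.
exact: IH.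
Qed.

Lemma cvol_eq0 cs u v : (u < 0) || (v < 0) -> cvol cs u v = 0%E.
Proof.
elim: cs u v => [|c cs IH] u v uv /=.
  by case: (lerP 0 u) (lerP 0 v) uv => [u0|u0] [v0|v0] //=.
apply: integral0_eq => x _; apply: IH.
have n1 := normr_ge0 x; have n2 := normr_ge0 (x - c).
by case/orP: uv => uv; apply/orP; [left|right]; lra.
Qed.

Lemma cell_or_out (p h x : R) M : 0 < h ->
  [\/ exists j : 'I_M, cell p h j x, x < p | p + M%:R * h <= x].
Proof.
move=> h0; elim: M => [|M [[j xj]|xp|xM]].
- by rewrite mul0r addr0; case: (ltP x p) => ?; [constructor 2|constructor 3].
- by constructor 1; exists (widen_ord (leqnSn M) j).
- by constructor 2.
- have [xM1|] := ltP x (p + M.+1%:R * h); last by constructor 3.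
  by constructor 1; exists ord_max; apply/cellP; rewrite xM.
Qed.

(** * Upper and lower bounds for the volume in terms of [cnt] *)

Section Sandwich.
Variables (h : R) (D : nat).

Definition near_grid (c : R) (k : nat) := `|c - k%:R * h| <= h.

Lemma cell_norm (x : R) (j : nat) : 0 < h -> cell (- (D%:R * h)) h j x ->
  h * (dist j D)%:R - h <= `|x|.
Proof.
move=> h0 /cellP; rewrite -natr1 natr_dist => /andP[x1 x2].
have -> : h * `|j%:R - D%:R| = `|h * (j%:R - D%:R)|.
  by rewrite normrM (gtr0_norm h0).
suff : `|h * (j%:R - D%:R) - x| <= h by have := ler_normB (h * (j%:R - D%:R) - x) (-x); rewrite opprK subrK normrN; lra.
by rewrite ler_norml; lra.
Qed.

(** One [h] is lost because [x] varies in its cell, the other because [c] is replaced by [k h]. *)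
Lemma cell_dist (x c : R) (j k : nat) : 0 < h -> cell (- (D%:R * h)) h j x ->
  near_grid c k -> h * (dist j (D + k))%:R - 2 * h <= `|x - c|.
Proof.
move=> h0 /cellP; rewrite -natr1 natr_dist natrD => /andP[x1 x2] ck.
have -> : h * `|j%:R - (D%:R + k%:R)| = `|h * (j%:R - (D%:R + k%:R))|.
  by rewrite normrM (gtr0_norm h0).
have hx : `|h * (j%:R - D%:R) - x| <= h by rewrite ler_norml; lra.
have : h * (j%:R - (D%:R + k%:R)) = (h * (j%:R - D%:R) - x) + ((c - k%:R * h) + (x - c)) by ring.
move=> ->; have := ler_normD (h * (j%:R - D%:R) - x) ((c - k%:R * h) + (x - c)).
by have := ler_normD (c - k%:R * h) (x - c); rewrite /near_grid in ck; lra.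
Qed.

Definition grid_approx := all2 (fun c k => (0 <= c) && `[< near_grid c k >]).

Lemma grid_approx_sum_ge0 cs ks : grid_approx cs ks -> 0 <= \sum_(c <- cs) c.
Proof.
elim: cs ks => [|c cs IH] [|k ks] //=; first by rewrite big_nil.
by move=> /andP[/andP[c0 _] /IH]; rewrite big_cons; lra.
Qed.

(** Each coordinate costs at most [h] in the first radius and [2 h] in the second. A point of the
    second ball has norm at most [v] plus the norm of the centre, so [a] has to reach only the
    minimum of this and [u]; that keeps the grid bounded even when [u / h] is huge. The triangle
    inequality carries the minimum through the induction. *)
Lemma cvol_le_cnt (cs : seq R) (ks : seq nat) (u v : R) (a b : nat) :
  0 < h -> grid_approx cs ks -> (a <= D)%N ->
  Num.min u (v + \sum_(c <- cs) c) + (size cs)%:R * h <= a%:R * h ->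
  v + 2 * (size cs)%:R * h <= b%:R * h ->
  (cvol cs u v <= (h ^+ size cs * (cnt D ks a b)%:R)%:E)%E.
Proof.
move=> h0; elim: cs ks u v a b => [|c cs IH] [|k ks] //= u v a b.
  by move=> _ _ _ _; rewrite lee_fin expr0 mul1r; case: (_ && _).
move=> /andP[/andP[c0 /asboolP ck] ksP] aD Ha Hb.
pose y (j : 'I_(D.*2.+1)) : R := h ^+ size cs *
  (if (dist j D <= a)%N && (dist j (D + k) <= b)%N
   then cnt D ks (a - dist j D) (b - dist j (D + k)) else 0)%:R.
rewrite exprS -mulrA natr_sum mulr_sumr.
rewrite big_cons -natr1 in Ha; rewrite -[(size cs).+1%:R]natr1 in Hb.
have triangle x : `|x| <= `|x - c| + c.
  by have := ler_normD (x - c) c; rewrite subrK (ger0_norm c0).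
have sum0 := grid_approx_sum_ge0 ksP.
have vanish u' v' : Num.min u' (v' + \sum_(c <- cs) c) < 0 -> cvol cs u' v' = 0%E.
  move=> uv; apply: cvol_eq0; move: uv; rewrite gt_min => /orP[->//|?].
  by apply/orP; right; lra.
have sh : 0 <= (size cs)%:R * h by rewrite mulr_ge0// ltW.
have neg (i l : nat) : (i < l)%N -> (i%:R - l%:R) * h < 0.
  by move=> il; rewrite pmulr_llt0// subr_lt0 ltr_nat.
(* Both hypotheses pass to the remaining coordinates. The differences of integer radii are taken in
   [R], so that this also covers the cells rejected by the tests of [cnt]: there a negative
   right-hand side forces the slice volume to be 0. *)
have main x (j : nat) : cell (- (D%:R * h)) h j x ->
  Num.min (u - `|x|) ((v - `|x - c|) + \sum_(c <- cs) c) + (size cs)%:R * h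
      <= (a%:R - (dist j D)%:R) * h
  /\ (v - `|x - c|) + 2 * (size cs)%:R * h <= (b%:R - (dist j (D + k))%:R) * h.
  move=> xj; have := cell_norm h0 xj; have := cell_dist h0 xj ck.
  have xc := triangle x => H1 H2; split; last by lra.
  move: Ha; rewrite -!lerBrDr !ge_min => /orP[Ha|Ha]; apply/orP; [left|right]; lra.
apply: (@integral_le_cells _ (- (D%:R * h)) h _ _ y) => //.
- by move=> j; rewrite mulr_ge0 ?exprn_ge0// ltW.
- by move=> x; exact: cvol_ge0.
- move=> x j xj; have [H1 H2] := main _ _ xj; rewrite /y.
  case: ifP => [/andP[ja jb]|/negbT].
    by apply: IH; rewrite ?natrB// (leq_trans (leq_subr _ _)).
  rewrite negb_and -!ltnNge mulr0 => /orP[/neg ja|/neg jb].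
    by rewrite vanish//; lra.
  by rewrite cvol_eq0//; apply/orP; right; lra.
- move=> x nx; apply: vanish.
  (* Off the grid the norm of [x] is at least [D h], hence at least [a h], which exhausts the first
     radius or the one implied by the second ball. *)
  have xD : D%:R * h <= `|x|.
    have [[j /nx//]|xp|xp] := cell_or_out (- (D%:R * h)) x D.*2.+1 h0.
      by rewrite ler_normr; apply/orP; right; lra.
    rewrite ler_normr; apply/orP; left.
    move: xp; rewrite [D.*2.+1%:R]mulrS -mul2n natrM mulrDl mul1r -mulrA.
    by lra.
  have aDh : a%:R * h <= D%:R * h by rewrite ler_pM2r// ler_nat.
  have xc := triangle x; rewrite gt_min; move: Ha; rewrite -lerBrDr ge_min.
  by move=> /orP[Ha|Ha]; apply/orP; [left|right]; lra.
Qed.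

(* Shrinking the grid by [1 + t] around [c / 2], a point of depth [r / 2] in
   both balls, pulls the cells that stick out of the body back into it. *)
Lemma cnt_le_cvol (cs : seq R) (ks : seq nat) (t u v : R) (a b : nat) :
  0 < h -> 0 <= t -> grid_approx cs ks ->
  a%:R * h + (size cs)%:R * h + t / 2 * \sum_(c <- cs) c <= (1 + t) * u ->
  b%:R * h + 2 * (size cs)%:R * h + t / 2 * \sum_(c <- cs) c <= (1 + t) * v ->
  (((h / (1 + t)) ^+ size cs * (cnt D ks a b)%:R)%:E <= cvol cs u v)%E.
Proof.
move=> h0 t0; have t1 : 0 < 1 + t by lra.
elim: cs ks u v a b => [|c cs IH] [|k ks] //= u v a b.
  rewrite big_nil !mulr0 mul0r !addr0 => _ Ha Hb.
  have u0 : 0 <= u.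
    by rewrite -(pmulr_rge0 _ t1); apply: le_trans Ha; rewrite mulr_ge0// ltW.
  have v0 : 0 <= v.
    by rewrite -(pmulr_rge0 _ t1); apply: le_trans Hb; rewrite mulr_ge0// ltW.
  by rewrite u0 v0 expr0 mul1r.
move=> /andP[/andP[c0 /asboolP ck] ksP].
rewrite big_cons -natr1 => Ha Hb.
set h' := h / (1 + t).
have h'0 : 0 < h' by rewrite divr_gt0.
have hh' : h = (1 + t) * h' by rewrite /h'; field; lra.
pose y (j : 'I_(D.*2.+1)) : R := h' ^+ size cs *
  (if (dist j D <= a)%N && (dist j (D + k) <= b)%N
   then cnt D ks (a - dist j D) (b - dist j (D + k)) else 0)%:R.
rewrite exprS -mulrA natr_sum mulr_sumr.
(* The contraction sending [z] to [(z + t c / 2) / (1 + t)] fixes [c / 2]. Its constant term is [s],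
   so the image of cell [j] starts at [s + (j - D) h']. *)
pose s := t / 2 * c / (1 + t).
have hs : t / 2 * c = (1 + t) * s by rewrite /s; field; lra.
apply: (@cells_le_integral _ (s - D%:R * h') h' _ _ y) => //.
- by move=> j; rewrite mulr_ge0 ?exprn_ge0// ltW.
- by move=> x; exact: cvol_ge0.
move=> x j /cellP; rewrite -natr1 /y => /andP[x1 x2].
case: ifP => [/andP[ja jb]|_]; last by rewrite mulr0 cvol_ge0.
(* The offset within the original cell of the point that is contracted to [x]; it lies between 0 and
   [h]. *)
pose th := (1 + t) * (x - s - (j%:R - D%:R) * h').
have th0 : 0 <= th by apply: mulr_ge0; lra.
have th1 : th <= h by rewrite hh' ler_pM2l//; lra.
have ex : (1 + t) * x = (t / 2 * c + h * (j%:R - D%:R)) + th.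
  by rewrite /th hs hh'; ring.
have tc0 : 0 <= t / 2 * c by rewrite !mulr_ge0// invr_ge0.
have nx : (1 + t) * `|x| <= t / 2 * c + h * (dist j D)%:R + h.
  rewrite -{1}(gtr0_norm t1) -normrM ex natr_dist.
  apply: (le_trans (ler_normD _ _)); rewrite (ger0_norm th0) lerD//.
  by apply: (le_trans (ler_normD _ _)); rewrite (ger0_norm tc0) normrM (gtr0_norm h0).
have nxc : (1 + t) * `|x - c| <= t / 2 * c + h * (dist j (D + k))%:R + 2 * h.
  rewrite -{1}(gtr0_norm t1) -normrM natr_dist natrD.
  (* Since the fixed point is the midpoint of 0 and [c], the contraction costs the same [t c / 2]
     for both centres, here with the opposite sign. *)
  have -> : (1 + t) * (x - c) =
      h * (j%:R - (D%:R + k%:R)) + (th - t / 2 * c - (c - k%:R * h)).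
    by rewrite mulrBr ex; field.
  apply: (le_trans (ler_normD _ _)); rewrite normrM (gtr0_norm h0).
  move: ck; rewrite /near_grid => ck.
  have := ler_normB (th - t / 2 * c) (c - k%:R * h).
  have : `|th - t / 2 * c| <= h + t / 2 * c by rewrite ler_norml; lra.
  by lra.
by apply: IH; rewrite ?natrB//; lra.
Qed.

End Sandwich.
End Volume.

(** * Structured programs and their compilation *)

Inductive cmd :=
  | Block of seq instr
  | Seq of cmd & cmd
  | While of nat & nat & cmd
  | IfLe of nat & nat & cmd.

Fixpoint csize (c : cmd) : nat :=
  match c with
  | Block b => size b
  | Seq c1 c2 => csize c1 + csize c2
  | While _ _ c => csize c + 3
  | IfLe _ _ c => csize c + 2
  end.

(** Jump targets are absolute, hence the offset [o]. A test that succeeds skips the next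
    instruction, the exit; [IJle 0 0 l] always jumps, as a register is at most itself. *)
Fixpoint compile (o : nat) (c : cmd) : seq instr :=
  match c with
  | Block b => b
  | Seq c1 c2 => compile o c1 ++ compile (o + csize c1) c2
  | While i j c =>
      [:: IJle i j o.+2; IJle 0 0 (o + (csize c + 3))] ++ compile o.+2 c
      ++ [:: IJle 0 0 o]
  | IfLe i j c =>
      [:: IJle i j o.+2; IJle 0 0 (o + (csize c + 2))] ++ compile o.+2 c
  end.

Lemma size_compile c o : size (compile o c) = csize c.
Proof.
elim: c o => //= [c1 IH1 c2 IH2|i j c IH|i j c IH] o.
- by rewrite size_cat IH1 IH2.
- by rewrite size_cat IH /= addn1 addn3.
- by rewrite IH addn2.
Qed.

Definition regfile := nat -> rat.

Definition straight (x : instr) : bool :=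
  match x with IJle _ _ _ | IHalt => false | _ => true end.

Definition exec1 (R : regfile) (x : instr) : regfile :=
  match x with
  | IConst i q => upd R i q
  | IAdd i j k => upd R i (R j + R k)
  | ISub i j k => upd R i (R j - R k)
  | IMul i j k => upd R i (R j * R k)
  | IDiv i j k => upd R i (R j / R k)
  | ILoad i j => upd R i (R (addr (R j)))
  | IStore i j => upd R (addr (R i)) (R j)
  | _ => R
  end.

Definition exec_block := foldl exec1.

(** The last index is the exact number of machine steps: an iteration pays two more for the test and
    the jump back, a failed test two for itself and the exit jump. *)
Inductive ev : cmd -> regfile -> regfile -> nat -> Prop :=
  | EvBlock b R : all straight b -> ev (Block b) R (exec_block R b) (size b)
  | EvSeq c1 c2 R1 R2 R3 k1 k2 :
      ev c1 R1 R2 k1 -> ev c2 R2 R3 k2 -> ev (Seq c1 c2) R1 R3 (k1 + k2)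
  | EvWhileT i j c R1 R2 R3 k1 k2 : R1 i <= R1 j ->
      ev c R1 R2 k1 -> ev (While i j c) R2 R3 k2 ->
      ev (While i j c) R1 R3 (k1 + 2 + k2)
  | EvWhileF i j c R : ~~ (R i <= R j) -> ev (While i j c) R R 2
  | EvIfT i j c R R' k : R i <= R j -> ev c R R' k -> ev (IfLe i j c) R R' k.+1
  | EvIfF i j c R : ~~ (R i <= R j) -> ev (IfLe i j c) R R 2.

Definition code_at (p : program) (o : nat) (b : seq instr) :=
  exists p1 p2, p = p1 ++ b ++ p2 /\ size p1 = o.

Lemma code_at_catl p o b1 b2 : code_at p o (b1 ++ b2) -> code_at p o b1.
Proof. by move=> [p1 [p2 [-> <-]]]; exists p1, (b2 ++ p2); rewrite -catA. Qed.

Lemma code_at_catr p o b1 b2 :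
  code_at p o (b1 ++ b2) -> code_at p (o + size b1) b2.
Proof.
move=> [p1 [p2 [-> <-]]]; exists (p1 ++ b1), p2.
by rewrite -!catA size_cat.
Qed.

Lemma code_at_cons p o x b : code_at p o (x :: b) -> code_at p o.+1 b.
Proof. by rewrite -addn1; exact: (@code_at_catr _ _ [:: x]). Qed.

Lemma code_at_nth p o x b : code_at p o (x :: b) -> nth IHalt p o = x.
Proof. by move=> [p1 [p2 [-> <-]]]; rewrite nth_cat ltnn subnn. Qed.

#[local] Arguments run : simpl never.

Lemma runD p k1 k2 s : run p (k1 + k2) s = run p k2 (run p k1 s).
Proof. by rewrite /run addnC iterD. Qed.

Lemma run_block p o b R : all straight b -> code_at p o b ->
  run p (size b) (RamState o R) = RamState (o + size b) (exec_block R b).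
Proof.
elim: b o R => [|x b IH] o R /=; first by rewrite addn0.
move=> /andP[sx sb] pb; rewrite -[(size b).+1]add1n runD.
have -> : run p 1 (RamState o R) = RamState o.+1 (exec1 R x).
  by rewrite /run /= /step /cur_instr /= (code_at_nth pb); case: x sx {pb}.
by rewrite IH// ?addSnnS//; exact: code_at_cons pb.
Qed.

Lemma run_jle p o i j l b R : code_at p o (IJle i j l :: b) ->
  run p 1 (RamState o R) = RamState (if R i <= R j then l else o.+1) R.
Proof.
by move=> pb; rewrite /run /= /step /cur_instr /= (code_at_nth pb); case: ifP.
Qed.

(** Induction on the derivation, not on the command: the rest of a loop is the same command with a
    smaller derivation, run again from the same offset. *)
Lemma run_ev p c R R' k : ev c R R' k -> forall o, code_at p o (compile o c) ->
  run p k (RamState o R) = RamState (o + csize c) R'.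
Proof.
elim=> {c R R' k}.
- by move=> b R sb o /= pb; rewrite run_block.
- move=> c1 c2 R1 R2 R3 k1 k2 _ IH1 _ IH2 o /= pb.
  rewrite runD (IH1 _ (code_at_catl pb)) IH2 ?addnA//.
  by have := code_at_catr pb; rewrite size_compile.
- move=> i j c R1 R2 R3 k1 k2 Rij _ IH1 _ IH2 o pb; rewrite -[k1]/(0 + k1)%N.
  rewrite (_ : 0 + k1 + 2 + k2 = 1 + (k1 + (1 + k2)))%N; last by lia.
  rewrite runD (run_jle _ pb) Rij runD.
  have pb2 : code_at p o.+2 (compile o.+2 c ++ [:: IJle 0 0 o]).
    exact: code_at_cons (code_at_cons pb).
  rewrite IH1; last exact: code_at_catl pb2.
  rewrite runD.
  have := code_at_catr pb2; rewrite size_compile => /run_jle ->.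
  by rewrite lexx IH2.
- move=> i j c R Rij o pb; rewrite -[2%N]/(1 + 1)%N runD (run_jle _ pb) (negPf Rij).
  rewrite (@run_jle _ _ 0 0 (o + (csize c + 3)) (compile o.+2 c ++ [:: IJle 0 0 o])) ?lexx//.
  exact: code_at_cons pb.
- move=> i j c R R' k Rij _ IH o pb; rewrite -[k.+1]add1n runD (run_jle _ pb) Rij.
  rewrite IH /=; first by rewrite addn2 !addnS addSn.
  exact: code_at_cons (code_at_cons pb).
- move=> i j c R Rij o pb; rewrite -[2%N]/(1 + 1)%N runD (run_jle _ pb) (negPf Rij).
  rewrite (@run_jle _ _ 0 0 (o + (csize c + 2)) (compile o.+2 c)) ?lexx//.
  exact: code_at_cons pb.
Qed.

(** * Total correctness within a time budget, and frame conditions *)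

Definition wp (c : cmd) (R : regfile) (T : nat) (Q : regfile -> Prop) :=
  exists R' k, [/\ ev c R R' k, (k <= T)%N & Q R'].

Lemma wp_weaken c R T T' (Q Q' : regfile -> Prop) :
  wp c R T Q -> (T <= T')%N -> (forall R', Q R' -> Q' R') -> wp c R T' Q'.
Proof.
move=> [R' [k [H1 H2 H3]]] TT QQ; exists R', k; split=> //; last exact: QQ.
exact: leq_trans TT.
Qed.

Lemma wp_block b R T (Q : regfile -> Prop) : all straight b ->
  (size b <= T)%N -> Q (exec_block R b) -> wp (Block b) R T Q.
Proof. by move=> sb bT QR; exists (exec_block R b), (size b); split=> //; exact: EvBlock. Qed.

Lemma wp_seq T1 T2 c1 c2 R T (Q1 Q : regfile -> Prop) : (T1 + T2 <= T)%N ->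
  wp c1 R T1 Q1 -> (forall R1, Q1 R1 -> wp c2 R1 T2 Q) ->
  wp (Seq c1 c2) R T Q.
Proof.
move=> leT [R1 [k1 [e1 le1 q1]]] /(_ _ q1) [R2 [k2 [e2 le2 q2]]].
exists R2, (k1 + k2)%N; split=> //; first exact: EvSeq e1 e2.
exact: leq_trans (leq_add le1 le2) leT.
Qed.

Lemma wp_if T1 i j c R T (Q : regfile -> Prop) : (T1 + 2 <= T)%N ->
  (R i <= R j -> wp c R T1 Q) -> (~~ (R i <= R j) -> Q R) ->
  wp (IfLe i j c) R T Q.
Proof.
move=> leT HT HF; have [Rij|Rij] := boolP (R i <= R j).
  have [R' [k [e le q]]] := HT Rij; exists R', k.+1; split=> //.
    exact: EvIfT.
  by lia.
by exists R, 2; split; [exact: EvIfF|lia|exact: HF].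
Qed.

(** All loops here have an iteration count [m] known in advance, so the invariant is indexed by the
    number of completed iterations and no separate variant is needed to ensure termination. *)
Lemma wp_while m T1 (Inv : nat -> regfile -> Prop) i j c R T :
  (m * (T1 + 2) + 2 <= T)%N ->
  (forall l R, (l < m)%N -> Inv l R -> R i <= R j /\ wp c R T1 (Inv l.+1)) ->
  (forall R, Inv m R -> ~~ (R i <= R j)) ->
  Inv 0 R -> wp (While i j c) R T (Inv m).
Proof.
move=> leT Hstep Hend; suff gen l R1 : (l <= m)%N -> Inv (m - l)%N R1 ->
    wp (While i j c) R1 (l * (T1 + 2) + 2) (Inv m).
  move=> H0; apply: (wp_weaken (gen m R _ _)) => //; last by rewrite subnn.
elim: l R1 => [|l IH] R1 lm I1.
  rewrite subn0 in I1; exists R1, 2; split=> //; exact/EvWhileF/Hend.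
have [|Rij [R2 [k [e2 le2 I2]]]] := Hstep _ _ _ I1; first by lia.
have [||R3 [k3 [e3 le3 I3]]] := IH R2; first exact: ltnW.
  by move: I2; rewrite (_ : (m - l.+1).+1 = (m - l)%N)//; lia.
exists R3, (k + 2 + k3)%N; split=> //; first exact: EvWhileT e3.
by rewrite mulSn; lia.
Qed.

(** Frame condition: [l] lists the registers that may have changed. *)
Definition same (l : seq nat) (R R' : regfile) :=
  forall j, j \notin l -> R' j = R j.

Lemma same_trans l l' R1 R2 R3 : same l' R2 R3 -> all (mem l) l' ->
  same l R1 R2 -> same l R1 R3.
Proof.
move=> s2 /allP ll s1 j jl; rewrite s2 ?s1//.
by apply: contra jl => /ll.
Qed.

Lemma upd_same l R R' i v : i \in l -> same l R R' -> same l R (upd R' i v).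
Proof.
by move=> il s j jl; rewrite /upd; case: eqP => [ji|_]; [rewrite ji il in jl|exact: s].
Qed.

Lemma upd_eq R i v : upd R i v i = v.
Proof. by rewrite /upd eqxx. Qed.

Lemma upd_neq R i v j : j != i -> upd R i v j = R j.
Proof. by rewrite /upd => /negPf ->. Qed.

Lemma addr_nat m : addr m%:R = m.
Proof.
have -> : m%:R = m%:Z%:~R :> rat by [].
by rewrite /addr denq_int numq_int eqxx.
Qed.

(** The machine has no rounding, so the floor plus one is found by counting up until [x] is
    exceeded. The time is linear in the value, which is affordable as every value rounded is
    [O(L)]. *)
Definition floorS (i x : nat) : cmd :=
  Seq (Block [:: IConst i 0]) (While i x (Block [:: IAdd i i 6])).

Lemma wp_floorS i x (R : regfile) : x != i -> i != 6 -> R 6 = 1 -> 0 <= R x ->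
  wp (floorS i x) R (3 * Num.truncn (R x) + 6)
    (fun R' : regfile => R' i = (Num.truncn (R x)).+1%:R /\ same [:: i] R R').
Proof.
move=> xi i6 R6 Rx; set m := Num.truncn (R x).
have /andP[m1 m2] := truncn_itv Rx.
apply: (wp_seq (T1 := 1) (T2 := 3 * m + 5)
   (Q1 := fun R1 : regfile => R1 i = 0%:R /\ same [:: i] R R1)).
- by lia.
- apply: wp_block => //=; split; first by rewrite upd_eq.
  by apply: upd_same; rewrite ?mem_head.
move=> R1 I1; apply: (wp_while (T1 := 1)
  (Inv := fun l (R' : regfile) => R' i = l%:R /\ same [:: i] R R')) => //.
- by lia.
- move=> l R2 lm [e2 s2]; rewrite e2 s2 ?inE//; split.
    by apply: le_trans m1; rewrite ler_nat.
  apply: wp_block => //=; split; last by apply: upd_same; rewrite ?mem_head.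
  by rewrite upd_eq e2 s2 ?inE 1?eq_sym// R6 natr1.
by move=> R2 [e2 s2]; rewrite e2 s2 ?inE// -ltNge.
Qed.

(** * The dynamic program *)

(* Throughout, register 6 holds 1 and register 29 holds 0. *)
Definition absdiff (a x y : nat) : cmd :=
  Seq (Block [:: ISub a x y]) (IfLe a 29 (Block [:: ISub a 29 a])).

Lemma wp_absdiff a x y (R : regfile) (m p : nat) : a != 29 -> R 29 = 0 ->
  R x = m%:R -> R y = p%:R ->
  wp (absdiff a x y) R 4 (fun R' : regfile => R' a = (dist m p)%:R /\ same [:: a] R R').
Proof.
move=> a29 R29 Rx Ry.
apply: (wp_seq (T1 := 1) (T2 := 3) (Q1 := fun R1 : regfile => R1 a = m%:R - p%:R /\ same [:: a] R R1)) => //.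
  apply: wp_block => //=; split; first by rewrite upd_eq Rx Ry.
  by apply: upd_same; rewrite ?mem_head.
move=> R1 [e1 s1]; apply: (wp_if (T1 := 1)) => //.
  rewrite e1 s1 ?inE 1?eq_sym// R29 => mp; apply: wp_block => //=; split.
    by rewrite upd_eq e1 s1 ?inE 1?eq_sym// R29 sub0r natr_dist ler0_norm.
  by apply: upd_same; rewrite ?mem_head.
rewrite e1 s1 ?inE 1?eq_sym// R29 -ltNge => mp.
by rewrite natr_dist gtr0_norm.
Qed.

Definition scanregs : seq nat := [:: 22; 24; 25; 26; 27; 28].

(** Registers 25 and 26 receive the distances of grid point 22 from 0 and from the centre, 27 the
    row-major address of the entry for the reduced radii, and 24 the running sum. *)
Definition scan : cmd :=
  While 22 23
    (Seq (absdiff 25 22 13)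
    (Seq (absdiff 26 22 19)
    (Seq (IfLe 25 20 (IfLe 26 21 (Block [:: ISub 27 20 25; IMul 27 27 14;
                        ISub 28 21 26; IAdd 27 27 28; IAdd 27 27 16;
                        ILoad 28 27; IAdd 24 24 28])))
         (Block [:: IAdd 22 22 6])))).

Definition window (D k u w : nat) (tab : nat -> nat -> rat) (j : nat) : rat :=
  if (dist j D <= u)%N && (dist j (D + k) <= w)%N
  then tab (u - dist j D)%N (w - dist j (D + k))%N else 0.

Definition table_at (R : regfile) (B D : nat) (tab : nat -> nat -> rat) :=
  forall a b, (a <= D)%N -> (b <= D)%N -> R (B + (a * D.+1 + b))%N = tab a b.

(** Scratch registers lie below 64, the copied input and the tables from 64 on, so frame conditions
    on scratch registers preserve the data. *)
Lemma notin_small l m : all (gtn 64) l -> (63 < m)%N -> m \notin l.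
Proof.
by move=> /allP l64 m63; apply/negP => /l64 /=; rewrite ltnNge m63.
Qed.

Lemma wp_scan (R : regfile) (D B k u w : nat) tab : (u <= D)%N -> (w <= D)%N ->
  (63 < B)%N ->
  R 6 = 1 -> R 29 = 0 -> R 13 = D%:R -> R 14 = D.+1%:R -> R 16 = B%:R ->
  R 19 = (D + k)%:R -> R 20 = u%:R -> R 21 = w%:R -> R 23 = D.*2%:R ->
  table_at R B D tab -> R 22 = 0 -> R 24 = 0 ->
  wp scan R (D.*2.+1 * 22 + 2)
    (fun R' : regfile => R' 24 = \sum_(j < D.*2.+1) window D k u w tab j /\
               same scanregs R R').
Proof.
move=> uD wD B63 R6 R29 R13 R14 R16 R19 R20 R21 R23 Rtab R22 R24.
pose Inv l (R' : regfile) := [/\ R' 22 = l%:R,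
  R' 24 = \sum_(j < l) window D k u w tab j & same scanregs R R'].
suff /wp_weaken : wp scan R (D.*2.+1 * 22 + 2) (Inv D.*2.+1).
  by apply=> // R' [].
apply: (wp_while (T1 := 20) (Inv := Inv)) => // [l R1 lD [e22 e24 s1]|R1 [e22 _ s1]|];
  last 2 first.
- by rewrite e22 s1// R23 ler_nat ltnn.
- by split=> //; rewrite big_ord0.
split; first by rewrite e22 s1// R23 ler_nat -ltnS.
apply: (wp_seq (T1 := 4) (T2 := 16)) => //; first by apply: (@wp_absdiff _ _ _ _ l D) => //; rewrite s1.
move=> R2 [e25 s20]; have s2 : same scanregs R R2 by apply: same_trans s20 _ s1.
apply: (wp_seq (T1 := 4) (T2 := 12)) => //.
  by apply: (@wp_absdiff _ _ _ _ l (D + k)); rewrite // ?[R2 22]s20// s2.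
move=> R3 [e26 s30]; have e25' : R3 25 = (dist l D)%:R by rewrite s30.
have s3 : same scanregs R R3 by apply: same_trans s30 _ s2.
have e22' : R3 22 = l%:R by rewrite s30// s20.
have e24' : R3 24 = \sum_(j < l) window D k u w tab j by rewrite s30// s20.
pose Q (R' : regfile) := [/\ R' 22 = l%:R, R' 24 = \sum_(j < l.+1) window D k u w tab j
   & same scanregs R R'].
apply: (wp_seq (T1 := 11) (T2 := 1) (Q1 := Q)) => //.
  apply: (wp_if (T1 := 9)) => //; last first.
    rewrite e25' s3// R20 ler_nat => /negPf nd; split=> //.
    by rewrite big_ord_recr /= /window nd addr0.
  rewrite e25' s3// R20 ler_nat => dl; apply: (wp_if (T1 := 7)) => //; last first.
    rewrite e26 s3// R21 ler_nat => /negPf nd; split=> //.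
    by rewrite big_ord_recr /= /window nd andbF addr0.
  rewrite e26 s3// R21 ler_nat => dr; apply: wp_block => //.
  have a27 : (R3 20 - R3 25) * R3 14 + (R3 21 - R3 26) + R3 16 =
      (B + ((u - dist l D) * D.+1 + (w - dist l (D + k))))%:R.
    rewrite e25' e26 !s3// R20 R21 R14 R16 addrC.
    by rewrite 2!natrD natrM !natrB.
  have Rt : R3 (B + ((u - dist l D) * D.+1 + (w - dist l (D + k))))%N =
      tab (u - dist l D)%N (w - dist l (D + k))%N.
    rewrite s3 ?Rtab ?(leq_trans (leq_subr _ _))//.
    by apply: notin_small => //; rewrite ltn_addr.
  split; rewrite /=.
  - by rewrite /upd /=.
  - rewrite big_ord_recr /= /window dl dr /= -Rt -e24'.
    rewrite /upd /= a27 addr_nat.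
    by rewrite !gtn_eqF// ltn_addr// (leq_trans _ B63).
  - by do !(apply: upd_same => //).
move=> R4 [f22 f24 s4]; apply: wp_block => //; split.
- by rewrite /= upd_eq f22 s4// R6 natr1.
- by rewrite /= upd_neq.
- by apply: upd_same.
Qed.

(* Registers 20 and 21 run through the pairs (u, w) of radii, 22 through the
   grid points j; 16 and 17 point to the previous and to the new table. *)
Definition layer : cmd :=
  Seq (Block [:: IConst 20 0])
  (While 20 13
    (Seq (Block [:: IConst 21 0])
    (Seq
      (While 21 13
        (Seq (Block [:: IConst 24 0; IConst 22 0])
        (Seq scan
          (Block [:: IMul 27 20 14; IAdd 27 27 21; IAdd 27 27 17;
                     IMul 24 24 10; IStore 27 24; IAdd 21 21 6]))))
      (Block [:: IAdd 20 20 6])))).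

Definition layerregs : seq nat := [:: 20; 21; 22; 24; 25; 26; 27; 28].

(** Frame condition for code that also writes a table at addresses from [B] on. *)
Definition same_below (l : seq nat) (B : nat) (R R' : regfile) :=
  forall j, (j < B)%N -> j \notin l -> R' j = R j.

Lemma same_below_trans l l' B R1 R2 R3 : same_below l' B R2 R3 -> all (mem l) l' ->
  same_below l B R1 R2 -> same_below l B R1 R3.
Proof.
move=> s2 /allP ll s1 j jB jl; rewrite s2 ?s1//.
by apply: contra jl => /ll.
Qed.

Lemma sameW l B R R' : same l R R' -> same_below l B R R'.
Proof. by move=> s j _; exact: s. Qed.

Lemma upd_same_below l B R R' i v : (i \in l) || (B <= i)%N ->
  same_below l B R R' -> same_below l B R (upd R' i v).
Proof.
move=> il s j jB jl; rewrite /upd; case: eqP => [ji|_]; last exact: s.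
by move: il; rewrite -ji (negPf jl) leqNgt jB.
Qed.

Lemma flat_inj S a b a' b' : (b < S)%N -> (b' < S)%N ->
  (a * S + b = a' * S + b')%N -> a = a' /\ b = b'.
Proof.
move=> bS b'S e; have S0 : (0 < S)%N by lia.
have ea : a = a'.
  by have := congr1 (divn^~ S) e; rewrite /= !divnMDl// !divn_small// !addn0.
by split=> //; move: e; rewrite ea => /addnI.
Qed.

Lemma wp_layer (R : regfile) (D B k : nat) (h : rat) tab :
  (63 < B)%N ->
  R 6 = 1 -> R 29 = 0 -> R 10 = h -> R 13 = D%:R -> R 14 = D.+1%:R ->
  R 16 = B%:R -> R 17 = (B + D.+1 * D.+1)%:R ->
  R 19 = (D + k)%:R -> R 23 = D.*2%:R -> table_at R B D tab ->
  wp layer R (D.+1 * (D.+1 * (D.*2.+1 * 22 + 12) + 6) + 3)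
    (fun R' : regfile => table_at R' (B + D.+1 * D.+1) D
                 (fun u w => \sum_(j < D.*2.+1) window D k u w tab j * h) /\
               same_below layerregs (B + D.+1 * D.+1) R R').
Proof.
move=> B63 R6 R29 R10 R13 R14 R16 R17 R19 R23 Rtab.
set B' := (B + D.+1 * D.+1)%N.
pose new u w := \sum_(j < D.*2.+1) window D k u w tab j * h.
(* Progress in row-major order. Position [(u, D + 1)] coincides with [(u + 1, 0)], so the end of the
   inner loop is the next state of the outer one. *)
pose filled u w (R' : regfile) := forall a b, (b <= D)%N ->
  (a * D.+1 + b < u * D.+1 + w)%N -> R' (B' + (a * D.+1 + b))%N = new a b.
have low j : (j < 64)%N -> (j < B')%N.
  by move=> j64; apply: leq_trans j64 _; rewrite ltn_addr.
apply: (wp_seq (T1 := 1) (T2 := D.+1 * (D.+1 * (D.*2.+1 * 22 + 12) + 6) + 2)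
  (Q1 := fun R1 : regfile => R1 20 = 0 /\ same_below layerregs B' R R1)).
- by lia.
- apply: wp_block => //; split; first by rewrite /= upd_eq.
  by apply: upd_same_below.
move=> R1 [e20 s1].
pose Inv u (R' : regfile) := [/\ R' 20 = u%:R, filled u 0%N R' & same_below layerregs B' R R'].
suff /wp_weaken : wp (While 20 13
    (Seq (Block [:: IConst 21 0])
    (Seq
      (While 21 13
        (Seq (Block [:: IConst 24 0; IConst 22 0])
        (Seq scan
          (Block [:: IMul 27 20 14; IAdd 27 27 21; IAdd 27 27 17;
                     IMul 24 24 10; IStore 27 24; IAdd 21 21 6]))))
      (Block [:: IAdd 20 20 6])))) R1 (D.+1 * (D.+1 * (D.*2.+1 * 22 + 12) + 6) + 2) (Inv D.+1).
  apply=> // R' [_ f s]; split=> // a b aD bD; apply: f => //.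
  by rewrite addn0; nia.
apply: (wp_while (T1 := D.+1 * (D.*2.+1 * 22 + 12) + 4)).
- by lia.
- move=> u R2 uD [f20 f2 s2]; split.
    by rewrite f20 s2 ?low// R13 ler_nat -ltnS.
  apply: (wp_seq (T1 := 1) (T2 := D.+1 * (D.*2.+1 * 22 + 12) + 3)
    (Q1 := fun R3 : regfile => [/\ R3 20 = u%:R, R3 21 = 0, filled u 0%N R3 & same_below layerregs B' R R3])).
  + by lia.
  + apply: wp_block => //; split; rewrite /=.
    * by rewrite upd_neq.
    * by rewrite upd_eq.
    * by move=> a b bD ab; rewrite upd_neq ?f2//; lia.
    * by apply: upd_same_below.
  move=> R3 [g20 g21 f3 s3].
  pose Inw w (R' : regfile) := [/\ R' 20 = u%:R, R' 21 = w%:R, filled u w R' & same_below layerregs B' R R'].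
  apply: (wp_seq (T1 := D.+1 * (D.*2.+1 * 22 + 12) + 2) (T2 := 1) (Q1 := Inw D.+1)).
  + by lia.
  + apply: (wp_while (T1 := D.*2.+1 * 22 + 10)).
    * by lia.
    * move=> w R4 wD [h20 h21 f4 s4].
      split; first by rewrite h21 s4 ?low// R13 ler_nat -ltnS.
      apply: (wp_seq (T1 := 2) (T2 := D.*2.+1 * 22 + 8)
        (Q1 := fun R5 : regfile => [/\ R5 22 = 0, R5 24 = 0 & same [:: 22; 24] R4 R5])).
      - by lia.
      - apply: wp_block => //; split; rewrite /=.
        + by rewrite upd_eq.
        + by rewrite upd_neq// upd_eq.
        + by do 2?apply: upd_same.
      move=> R5 [i22 i24 s5].
      have s5' : same_below layerregs B' R R5.
        by apply: same_below_trans (sameW s5) _ s4.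
      (* The old table ends where the new one begins, at [B'], so the entries written so far have
         not disturbed it. *)
      have tab5 : table_at R5 B D tab.
        move=> a b aD bD; rewrite s5' ?Rtab//; first by rewrite /B'; nia.
        by apply: notin_small; rewrite // ltn_addr.
      apply: (wp_seq (T1 := D.*2.+1 * 22 + 2) (T2 := 6)); first by lia.
        apply: (wp_scan (k := k) (u := u) (w := w) _ _ _ _ _ _ _ _ _ _ _ _ tab5);
          rewrite // ?[R5 20]s5 ?[R5 21]s5 ?s5' ?low//.
      move=> R6' [e24 s6].
      have s6' : same_below layerregs B' R R6'.
        by apply: same_below_trans (sameW s6) _ s5'.
      have k20 : R6' 20 = u%:R by rewrite s6// s5.
      have k21 : R6' 21 = w%:R by rewrite s6// s5.
      have a27 : R6' 20 * R6' 14 + R6' 21 + R6' 17 = (B' + (u * D.+1 + w))%:R.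
        rewrite k20 k21 !s6' ?low// R14 R17 -/B' addrC.
        by rewrite natrD [(u * _ + w)%:R]natrD natrM.
      set A := (B' + (u * D.+1 + w))%N in a27.
      have B'A : (B' <= A)%N by rewrite leq_addr.
      have nA i : (i < 64)%N -> i != A.
        by move=> /low iB; rewrite neq_ltn (leq_trans iB B'A).
      pose R7 := exec_block R6' [:: IMul 27 20 14; IAdd 27 27 21; IAdd 27 27 17;
                                   IMul 24 24 10].
      have r27 : R7 27 = A%:R by rewrite -a27 /R7 /upd.
      have r24 : R7 24 = new u w.
        rewrite /R7 /= /upd /= e24 s6' ?low// R10 /new.
        by rewrite big_distrl.
      have s7 : same [:: 24; 27] R6' R7 by rewrite /R7 /=; do 4?apply: upd_same.
      have s7' : same_below layerregs B' R R7.
        by apply: same_below_trans (sameW s7) _ s6'.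
      apply: wp_block => //.
      have -> : exec_block R6' [:: IMul 27 20 14; IAdd 27 27 21; IAdd 27 27 17;
          IMul 24 24 10; IStore 27 24; IAdd 21 21 6] =
          upd (upd R7 A (new u w)) 21 w.+1%:R.
        rewrite -[LHS]/(exec_block R7 [:: IStore 27 24; IAdd 21 21 6]) /=.
        rewrite r27 addr_nat r24 upd_neq ?nA// [upd _ _ _ 6]upd_neq ?nA//.
        by rewrite s7// k21 s7' ?low// R6 natr1.
      split.
      - by rewrite upd_neq// upd_neq ?nA// s7.
      - by rewrite upd_eq.
      - move=> a b bD ab; have [eab|nab] := eqVneq (a * D.+1 + b)%N (u * D.+1 + w)%N.
          have [-> ->] := @flat_inj D.+1 _ _ _ _ bD wD eab.
          by rewrite upd_neq ?upd_eq// eq_sym nA.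
        rewrite upd_neq; last first.
          by rewrite eq_sym neq_ltn (leq_trans (low 21 isT))// leq_addr.
        have big l : all (gtn 64) l -> (B' + (a * D.+1 + b))%N \notin l.
          by move=> l64; apply: notin_small; rewrite // ltn_addr// low.
        rewrite upd_neq ?eqn_add2l// s7 ?big// s6 ?big// s5 ?big//.
        by apply: f4 => //; move: ab nab; rewrite addnS ltnS leq_eqVlt => /orP[/eqP->|//]; rewrite eqxx.
      - by apply: upd_same_below => //; apply: upd_same_below => //; rewrite B'A orbT.
    * by move=> R4 [_ h21 _ s4]; rewrite h21 s4 ?low// R13 ler_nat ltnn.
    * by [].
  move=> R4 [h20 h21 f4 s4]; apply: wp_block => //; split; rewrite /=.
  + by rewrite upd_eq h20 s4 ?low// R6 natr1.
  + move=> a b bD ab; rewrite upd_neq; last first.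
      by rewrite eq_sym neq_ltn (leq_trans (low 20 isT))// leq_addr.
    by rewrite addn0 mulSnr in ab; exact: f4.
  + by apply: upd_same_below.
- by move=> R2 [f20 _ s2]; rewrite f20 s2 ?low// R13 ler_nat ltnn.
- by split=> // a b _; rewrite mul0n.
Qed.

(* The input occupies registers 0 to n + 2; copying it to 64 n and beyond frees
   the registers below 64, whatever n is. *)
Definition relocate : cmd :=
  Seq (Block (nseq 6 (IAdd 0 0 0)))
  (Seq (Block [:: IStore 0 1; IConst 1 1; IAdd 0 0 1])
  (Seq (Block [:: IStore 0 2; ISub 0 0 1; IConst 1 64; IDiv 1 0 1; IConst 2 2;
                  IAdd 1 1 2; IConst 2 3])
  (While 2 1 (Block [:: ILoad 2 1; IAdd 1 1 0; IStore 1 2; ISub 1 1 0;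
                        IConst 2 1; ISub 1 1 2; IConst 2 3])))).

Definition relocated (n : nat) (delta r : rat) (c : seq rat) (R : regfile) :=
  [/\ R 0 = (64 * n)%:R, R (64 * n)%N = delta, R (64 * n + 1)%N = r &
      forall i, (i < n)%N -> R (64 * n + (3 + i))%N = nth 0 c i].

(** Six doublings turn register 0 into the address [64 n], which lies beyond the input as [n] is
    positive. Storing [delta] there frees register 1, storing [r] at the next address frees register
    2, and these two suffice for the copying loop; [n] is recovered as [64 n / 64]. *)
Lemma wp_relocate n delta r (c : seq rat) (R : regfile) : (0 < n)%N ->
  R 0 = n%:R -> R 1 = delta -> R 2 = r ->
  (forall i, (i < n)%N -> R (3 + i)%N = nth 0 c i) ->
  wp relocate R (9 * n + 18) (relocated n delta r c).
Proof.
move=> n0 R0 R1 R2 Rc.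
apply: (wp_seq (T1 := 6) (T2 := 9 * n + 12)
  (Q1 := fun R' : regfile => R' 0 = (64 * n)%:R /\ same [:: 0%N] R R')).
- by lia.
- apply: wp_block => //; split; last by rewrite /=; do 6?apply: upd_same.
  by rewrite /= /upd /= R0 natrM; ring.
move=> S1 [S10 sS1].
apply: (wp_seq (T1 := 3) (T2 := 9 * n + 9) (Q1 := fun R' : regfile =>
   [/\ R' 0 = (64 * n + 1)%:R, R' 1 = 1, R' 2 = r, R' (64 * n)%N = delta &
   forall i, (i < n)%N -> R' (3 + i)%N = nth 0 c i])).
- by lia.
- apply: wp_block => //; rewrite /= S10 addr_nat; split.
  + by rewrite /upd /= ltn_eqF ?S10 ?natrD//; lia.
  + by rewrite upd_neq// upd_eq.
  + by rewrite !upd_neq ?sS1//; lia.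
  + by rewrite 2?upd_neq ?upd_eq ?sS1//; lia.
  + by move=> i iN; rewrite !upd_neq ?sS1 ?Rc//; lia.
move=> S2 [S20 S21 S22 S2d S2c].
(* The pointer in register 1 descends from [n + 2] to 3, the last entry being copied first. Register
   2 serves as a buffer and is reset to the bound 3 before each test. *)
pose Inv l (R' : regfile) := [/\ [/\ R' 0 = (64 * n)%:R, R' 1 = (n + 2 - l)%:R & R' 2 = 3%:R],
  R' (64 * n)%N = delta, R' (64 * n + 1)%N = r,
  forall i, (i < n)%N -> R' (3 + i)%N = nth 0 c i &
  forall i, (i < n)%N -> (n <= i + l)%N -> R' (64 * n + (3 + i))%N = nth 0 c i].
apply: (wp_seq (T1 := 7) (T2 := 9 * n + 2) (Q1 := Inv 0%N)).
- by lia.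
- apply: wp_block => //.
  have -> : exec_block S2 [:: IStore 0 2; ISub 0 0 1; IConst 1 64; IDiv 1 0 1;
      IConst 2 2; IAdd 1 1 2; IConst 2 3] =
      exec_block (upd S2 (64 * n + 1) r) [:: ISub 0 0 1; IConst 1 64; IDiv 1 0 1;
      IConst 2 2; IAdd 1 1 2; IConst 2 3] by rewrite /= S20 addr_nat S22.
  set S3 := upd _ _ _.
  have S3j j : (j < 64)%N -> S3 j = S2 j by move=> j64; rewrite /S3 upd_neq//; lia.
  have e0 : S3 0 - S3 1 = (64 * n)%:R by rewrite !S3j// S20 S21 natrD addrK.
  have S3d : S3 (64 * n)%N = delta by rewrite /S3 upd_neq//; lia.
  have S3r : S3 (64 * n + 1)%N = r by rewrite /S3 upd_eq.
  have S3c i : (i < n)%N -> S3 (3 + i)%N = nth 0 c i.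
    by move=> iN; rewrite /S3 upd_neq ?S2c//; lia.
  clearbody S3; split; rewrite /=.
  + split; rewrite /upd /= ?e0 //.
    by rewrite natrM mulrC mulKf// subn0 natrD.
  + by rewrite !upd_neq//; lia.
  + by rewrite !upd_neq//; lia.
  + by move=> i iN; rewrite !upd_neq ?S3c//; lia.
  + by move=> i; lia.
move=> S3 I3.
suff /wp_weaken : wp (While 2 1 (Block [:: ILoad 2 1; IAdd 1 1 0; IStore 1 2; ISub 1 1 0;
                        IConst 2 1; ISub 1 1 2; IConst 2 3])) S3 (9 * n + 2) (Inv n).
  by apply=> // R' [[? _ _] ? ? _ cc]; split=> // i iN; apply: cc => //; rewrite leq_addl.
apply: (wp_while (T1 := 7)) => //.
- by lia.
- move=> l S4 ln [[f0 f1 f2] fd fr fc fC]; split.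
    by rewrite f1 f2 ler_nat; lia.
  apply: wp_block => //.
  have [i il iN] : exists2 i, (n + 2 - l = 3 + i)%N & (i < n)%N.
    by exists (n - l.+1)%N; lia.
  have ai : S4 1 = (3 + i)%:R by rewrite f1 il.
  have -> : exec_block S4 [:: ILoad 2 1; IAdd 1 1 0; IStore 1 2; ISub 1 1 0;
      IConst 2 1; ISub 1 1 2; IConst 2 3] =
      exec_block (upd (upd (upd S4 2 (nth 0 c i)) 1 (64 * n + (3 + i))%:R)
        (64 * n + (3 + i)) (nth 0 c i))
      [:: ISub 1 1 0; IConst 2 1; ISub 1 1 2; IConst 2 3].
    rewrite -[LHS]/(exec_block (exec_block S4 [:: ILoad 2 1; IAdd 1 1 0; IStore 1 2])
      [:: ISub 1 1 0; IConst 2 1; ISub 1 1 2; IConst 2 3]).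
    congr (exec_block _ _); rewrite /= ai addr_nat fc//.
    have -> : upd S4 2 (nth 0 c i) 1 + upd S4 2 (nth 0 c i) 0 = (64 * n + (3 + i))%:R.
      by rewrite !upd_neq// ai f0 addrC -natrD.
    by rewrite [X in upd _ (addr X)]upd_eq addr_nat [X in upd _ _ X]upd_neq// upd_eq.
  set S5 := upd (upd _ _ _) _ _.
  have S50 : S5 0 = (64 * n)%:R by rewrite /S5 !upd_neq//; lia.
  have S51 : S5 1 = (64 * n + (3 + i))%:R by rewrite /S5 upd_neq ?upd_eq//; lia.
  have S5j j : (2 < j)%N -> j != (64 * n + (3 + i))%N -> S5 j = S4 j.
    by move=> j2 jn; rewrite /S5 !upd_neq//; lia.
  have S5i : S5 (64 * n + (3 + i))%N = nth 0 c i by rewrite /S5 upd_eq.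
  clearbody S5; split; rewrite /=.
  + split; rewrite /upd /= ?S50 ?S51 //.
    rewrite (_ : n + 2 - l.+1 = 2 + i)%N; last by lia.
    by rewrite !natrD; ring.
  + by rewrite !upd_neq ?S5j//; lia.
  + by rewrite !upd_neq ?S5j//; lia.
  + by move=> i' iN'; rewrite !upd_neq ?S5j ?fc//; lia.
  + move=> i' iN' li'; have [->|ii'] := eqVneq i' i.
      by rewrite !upd_neq//; lia.
    by rewrite !upd_neq ?S5j ?fC//; lia.
- by move=> S4 [[_ f1 f2] _ _ _ _]; rewrite f1 f2 ler_nat; lia.
Qed.

(** * Computing the grid parameters *)

Definition setup : cmd :=
  Seq (Block [:: IConst 6 1; IConst 29 0; IConst 27 64; IDiv 3 0 27; IAdd 27 0 6])
  (Seq (Block [:: ILoad 4 0; ILoad 5 27])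
  (Seq (Block [:: IMul 30 3 3; IConst 27 16; IMul 30 27 30; IDiv 30 30 4])
  (Seq (floorS 8 30)
  (Seq (Block [:: IDiv 9 8 5; IDiv 10 5 8; IAdd 30 8 8])
  (Seq (IfLe 9 30 (Block [:: IAdd 30 9 29]))
  (Seq (floorS 11 30)
  (Seq (Block [:: IAdd 11 11 3; IAdd 12 8 3; IAdd 12 12 3; IAdd 13 8 8])
  (Seq (Block [:: IAdd 13 13 13; IAdd 14 13 6; IMul 15 14 14; IAdd 23 13 13])
  (Block [:: IAdd 16 0 0; IAdd 17 16 15; IAdd 27 16 29; ISub 28 17 6;
             IAdd 18 3 29]))))))))).

(** Chosen above [16 n^2 / delta], so that the mesh [h = r / L] satisfies [16 n^2 h <= delta r]. *)
Definition gridL (n : nat) (delta : rat) : nat :=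
  (Num.truncn (16 * (n%:R * n%:R) / delta)).+1.

(** In units of [h = r / L] the radius 1 is [L / r] and the radius [2 r] is [L + L]. The cap [2 r]
    bounds the norm on the second ball, whose centre has norm at most [r]; the additional [n] pays
    for the discretisation. *)
Definition gridU (n L : nat) (r : rat) : nat :=
  addn (Num.truncn (Num.min (L%:R / r) (L%:R + L%:R))).+1 n.

Definition params n L r (R : regfile) :=
  [/\ [/\ R 0 = (64 * n)%:R, R 6 = 1, R 29 = 0 & R 18 = n%:R],
      [/\ R 9 = L%:R / r, R 10 = r / L%:R, R 11 = (gridU n L r)%:R & R 12 = (L + n + n)%:R],
      [/\ R 13 = (4 * L)%:R, R 14 = (4 * L).+1%:R, R 15 = ((4 * L).+1 * (4 * L).+1)%:R
        & R 23 = (4 * L).*2%:R] &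
      R 16 = (128 * n)%:R /\ R 17 = (128 * n + (4 * L).+1 * (4 * L).+1)%:R].

Definition setupregs : seq nat :=
  [:: 3; 4; 5; 6; 8; 9; 10; 11; 12; 13; 14; 15; 16; 17; 18; 23; 27; 28; 29; 30].

Lemma wp_setup n delta r c (R : regfile) (L : nat) :
  gridL n delta = L ->
  (0 < n)%N -> 0 < delta -> 0 < r ->
  relocated n delta r c R ->
  wp setup R (9 * L + 42) (fun R' : regfile =>
    [/\ params n L r R', R' 27 = (128 * n)%:R,
        R' 28 = (128 * n + (4 * L).+1 * (4 * L).+1)%:R - 1 & same setupregs R R']).
Proof.
move=> eL n0 d0 r0 [R0 Rd Rr Rc].
apply: (wp_seq (T1 := 5) (T2 := 9 * L + 37) (Q1 := fun R' : regfile =>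
  [/\ R' 6 = 1, R' 29 = 0, R' 3 = n%:R, R' 27 = (64 * n + 1)%:R & same [:: 3; 6; 27; 29] R R'])).
- by lia.
- apply: wp_block => //; rewrite /=; split.
  + by rewrite /upd.
  + by rewrite /upd.
  + by rewrite /upd /= R0 natrM mulrC mulKf.
  + by rewrite /upd /= R0 natrD.
  + by do 5?apply: upd_same.
move=> R1 [a6 a29 a3 a27 s1].
apply: (wp_seq (T1 := 2) (T2 := 9 * L + 35) (Q1 := fun R' : regfile =>
  [/\ R' 4 = delta, R' 5 = r & same [:: 4; 5] R1 R'])).
- by lia.
- apply: wp_block => //; rewrite /=; split.
  + rewrite upd_neq// upd_eq [R1 0]s1// R0 addr_nat s1//.
    by apply: notin_small => //; lia.
  + rewrite upd_eq [upd _ 4 _ 27]upd_neq// a27 addr_nat upd_neq; last by lia.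
    by rewrite s1//; apply: notin_small => //; lia.
  + by do 2?apply: upd_same.
move=> R2 [b4 b5 s2].
apply: (wp_seq (T1 := 4) (T2 := 9 * L + 31) (Q1 := fun R' : regfile =>
  R' 30 = 16 * (n%:R * n%:R) / delta /\ same [:: 27; 30] R2 R')).
- by lia.
- apply: wp_block => //; rewrite /=; split; last by do 4?apply: upd_same.
  by rewrite /upd /= b4 !s2// a3.
move=> R3 [c30 s3].
have X0 : 0 <= 16 * (n%:R * n%:R) / delta :> rat.
  by rewrite !mulr_ge0 ?ler0n// invr_ge0 ltW.
apply: (wp_seq (T1 := 3 * L + 3) (T2 := 6 * L + 28) (Q1 := fun R' : regfile =>
  R' 8 = L%:R /\ same [:: 8%N] R3 R')).
- by lia.
- have := @wp_floorS 8 30 R3 isT isT; rewrite c30 s3// s2// => /(_ a6 X0) /wp_weaken.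
  by rewrite -/(gridL n delta) eL; apply=> //; rewrite -eL /gridL; lia.
move=> R4 [d8 s4].
have d5 : R4 5 = r by rewrite s4// s3.
have d3 : R4 3 = n%:R by rewrite s4// s3// s2.
have d6 : R4 6 = 1 by rewrite s4// s3// s2.
have d29 : R4 29 = 0 by rewrite s4// s3// s2.
have d0' : R4 0 = (64 * n)%:R by rewrite s4// s3// s2// s1.
have sR4 : same setupregs R R4.
  apply: same_trans s4 _ _ => //; apply: same_trans s3 _ _ => //.
  by apply: same_trans s2 _ _ => //; apply: same_trans s1 _ _.
apply: (wp_seq (T1 := 3) (T2 := 6 * L + 25) (Q1 := fun R' : regfile =>
  [/\ R' 9 = L%:R / r, R' 10 = r / L%:R, R' 30 = L%:R + L%:R & same [:: 9; 10; 30] R4 R'])).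
- by lia.
- by apply: wp_block => //; rewrite /=; split;
    [rewrite /upd /= d8 d5|rewrite /upd /= d8 d5|rewrite /upd /= d8|do 3?apply: upd_same].
move=> R5 [e9 e10 e30 s5].
apply: (wp_seq (T1 := 3) (T2 := 6 * L + 22) (Q1 := fun R' : regfile =>
  R' 30 = Num.min (L%:R / r) (L%:R + L%:R) /\ same [:: 30%N] R5 R')).
- by lia.
- apply: (wp_if (T1 := 1)) => //.
    rewrite e9 e30 => le; apply: wp_block => //; rewrite /= upd_eq e9 s5// d29 addr0.
    by split; [rewrite min_l|apply: upd_same].
  by rewrite e9 e30 -ltNge => le; split=> //; rewrite min_r// ltW.
move=> R6 [f30 s6].
have m0 : 0 <= Num.min (L%:R / r) (L%:R + L%:R) :> rat.
  by rewrite le_min divr_ge0 ?addr_ge0 ?ler0n// ltW.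
apply: (wp_seq (T1 := 6 * L + 6) (T2 := 13) (Q1 := fun R' : regfile =>
  R' 11 = (Num.truncn (Num.min (L%:R / r) (L%:R + L%:R))).+1%:R /\ same [:: 11%N] R6 R')).
- by lia.
- have := @wp_floorS 11 30 R6 isT isT; rewrite f30 s6// s5// => /(_ d6 m0) /wp_weaken.
  apply=> //; rewrite (_ : 6 * L + 6 = 3 * (L + L) + 6)%N; last by lia.
  rewrite leq_add2r leq_mul2l /= -(ler_nat rat).
  by have /andP[+ _] := truncn_itv m0; move=> /le_trans -> //; rewrite natrD ge_min lexx orbT.
move=> R7 [g11 s7].
have sR7 : same setupregs R R7.
  apply: same_trans s7 _ _ => //; apply: same_trans s6 _ _ => //.
  by apply: same_trans s5 _ _.
have g (j : nat) : j \notin [:: 9; 10; 11; 30] -> R7 j = R4 j.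
  rewrite !inE !negb_or => /and4P[j9 j10 j11 j30].
  by rewrite s7 ?inE// s6 ?inE// s5// !inE !negb_or j9 j10.
have g3 : R7 3 = n%:R by rewrite g.
have g8 : R7 8 = L%:R by rewrite g.
have g6 : R7 6 = 1 by rewrite g.
have g29 : R7 29 = 0 by rewrite g.
have g0 : R7 0 = (64 * n)%:R by rewrite g.
have g9 : R7 9 = L%:R / r by rewrite s7// s6.
have g10 : R7 10 = r / L%:R by rewrite s7// s6.
clear - g3 g8 g6 g29 g0 g9 g10 g11 sR7.
apply: (wp_seq (T1 := 4) (T2 := 9) (Q1 := fun R' : regfile =>
  [/\ R' 11 = (gridU n L r)%:R, R' 12 = (L + n + n)%:R, R' 13 = (L + L)%:R
    & same [:: 11; 12; 13] R7 R'])) => //.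
  apply: wp_block => //; rewrite /=; split; last by do 4?apply: upd_same.
  - by rewrite /upd /= g11 g3 /gridU natrD.
  - by rewrite /upd /= g8 g3 !natrD.
  - by rewrite /upd /= g8 -natrD.
move=> R8 [h11 h12 h13 s8].
apply: (wp_seq (T1 := 4) (T2 := 5) (Q1 := fun R' : regfile =>
  [/\ R' 13 = (4 * L)%:R, R' 14 = (4 * L).+1%:R, R' 15 = ((4 * L).+1 * (4 * L).+1)%:R,
    R' 23 = (4 * L).*2%:R & same [:: 13; 14; 15; 23] R8 R'])) => //.
  have e4 : (L + L)%:R + (L + L)%:R = (4 * L)%:R :> rat.
    by rewrite -natrD; congr _%:R; lia.
  apply: wp_block => //; rewrite /=; split; last by do 4?apply: upd_same.
  - by rewrite /upd /= h13.
  - by rewrite /upd /= h13 e4 s8// g6 natr1.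
  - by rewrite /upd /= h13 e4 s8// g6 natr1 -natrM.
  - by rewrite /upd /= h13 e4 -natrD addnn.
move=> R9 [i13 i14 i15 i23 s9].
have i0 : R9 0 = (64 * n)%:R by rewrite s9// s8.
have i3 : R9 3 = n%:R by rewrite s9// s8.
have i6 : R9 6 = 1 by rewrite s9// s8.
have i29 : R9 29 = 0 by rewrite s9// s8.
have i9 : R9 9 = L%:R / r by rewrite s9// s8.
have i10 : R9 10 = r / L%:R by rewrite s9// s8.
have i11 : R9 11 = (gridU n L r)%:R by rewrite s9.
have i12 : R9 12 = (L + n + n)%:R by rewrite s9.
have sR9 : same setupregs R R9.
  by apply: same_trans s9 _ _ => //; apply: same_trans s8 _ _.
clear - i0 i3 i6 i29 i9 i10 i11 i12 i13 i14 i15 i23 sR9.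
have e128 : R9 0 + R9 0 = (128 * n)%:R by rewrite i0 -natrD; congr _%:R; lia.
apply: wp_block => //; rewrite /=; split; last by do 5?apply: upd_same.
- by split; split; rewrite /upd //= ?e128 ?i15 ?i29 ?addr0 -?natrD.
- by rewrite /upd /= e128 i29 addr0.
- by rewrite /upd /= e128 i15 i6 -natrD.
Qed.

(** * Initial table, one layer per coordinate, and the answer *)

Definition fill : cmd := While 27 28 (Block [:: IStore 27 6; IAdd 27 27 6]).

(** Ones form the table of level 0, where no coordinate is left. Register 28 holds the last address
    rather than the one after it, because loop tests are non-strict. *)
Lemma wp_fill (R : regfile) (B m : nat) : (63 < B)%N ->
  R 6 = 1 -> R 27 = B%:R -> R 28 = (B + m)%:R - 1 ->
  wp fill R (4 * m + 2) (fun R' : regfile =>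
    (forall q, (q < m)%N -> R' (B + q)%N = 1) /\ same_below [:: 27%N] B R R').
Proof.
move=> B63 R6 R27 R28; have low j : (j < 64)%N -> (j < B)%N by lia.
pose Inv l (R' : regfile) := [/\ R' 27 = (B + l)%:R,
  forall q, (q < l)%N -> R' (B + q)%N = 1 & same_below [:: 27%N] B R R'].
suff /wp_weaken : wp fill R (4 * m + 2) (Inv m) by apply=> // R' [].
apply: (wp_while (T1 := 2)).
- by lia.
- move=> l R1 lm [e27 f s]; split.
    by rewrite e27 s ?low// R28 lerBrDr natr1 ler_nat -addnS leq_add2l.
  apply: wp_block => //=; rewrite e27 addr_nat s ?low// R6.
  have nB q j : (j < 64)%N -> j != (B + q)%N by lia.
  split.
  + by rewrite upd_eq !upd_neq ?nB// e27 s ?low// R6 natr1 addnS.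
  + move=> q ql; rewrite upd_neq; last by rewrite eq_sym nB.
    have [->|ql'] := eqVneq q l; first by rewrite upd_eq.
    by rewrite upd_neq ?eqn_add2l// f//; lia.
  + by apply: upd_same_below => //; apply: upd_same_below; rewrite ?leq_addr ?orbT.
- by move=> R1 [e27 _ s]; rewrite e27 s ?low// R28 -ltNge ltrBlDr ltrDl.
- by split; rewrite ?addn0.
Qed.

(** Coordinates are treated from the last to the first, as [cnt] on a list needs its values on the
    tail. Register 18 counts those left and also locates the entry to read; each layer gets a fresh
    table right after the previous one. *)
Definition coordinate : cmd :=
  Seq (Block [:: IAdd 27 0 18; IConst 28 2; IAdd 27 27 28; ILoad 30 27; IMul 30 30 9])
  (Seq (floorS 19 30)
  (Seq (Block [:: IAdd 19 19 13])
  (Seq layer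
       (Block [:: IAdd 16 17 29; IAdd 17 17 15; ISub 18 18 6])))).

Definition answer : cmd :=
  Block [:: IMul 27 11 14; IAdd 27 27 12; IAdd 27 27 16; ILoad 0 27].

Definition algorithm : cmd :=
  Seq relocate (Seq setup (Seq fill (Seq (While 6 18 coordinate) answer))).

Definition gridks (L : nat) (r : rat) (c : seq rat) : seq nat :=
  [seq (Num.truncn (x * (L%:R / r))).+1 | x <- c].

(** The table after [l] layers: the last [l] coordinates are summed out, each layer having
    contributed one factor [h = r / L]. *)
Definition leveltab n L (r : rat) (c : seq rat) (l : nat) (u w : nat) : rat :=
  (r / L%:R) ^+ l * (cnt (4 * L) (drop (n - l) (gridks L r c)) u w)%:R.

Lemma leveltabS n L r c l u w : size c = n -> (l < n)%N ->
  leveltab n L r c l.+1 u w =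
  \sum_(j < (4 * L).*2.+1)
    window (4 * L) (nth 0 (gridks L r c) (n - l.+1)) u w (leveltab n L r c l) j
    * (r / L%:R).
Proof.
move=> sc ln; have sk : size (gridks L r c) = n by rewrite size_map.
rewrite {1}/leveltab (drop_nth 0) ?sk; last by lia.
rewrite (_ : (n - l.+1).+1 = n - l)%N; last by lia.
rewrite [cnt _ _ _ _]/= natr_sum mulr_sumr; apply: eq_bigr => j _.
by rewrite exprSr /window /leveltab; case: ifP => _; rewrite ?mulr0 ?mul0r// mulrAC.
Qed.

Definition layercost D := (D.+1 * (D.+1 * (D.*2.+1 * 22 + 12) + 6) + 3)%N.

Definition mainregs : seq nat := [:: 16; 17; 18; 19; 20; 21; 22; 24; 25; 26; 27; 28; 30].

Lemma wp_main n L r (c : seq rat) (R : regfile) : (0 < n)%N -> size c = n ->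
  (0 < L)%N -> 0 < r ->
  (forall i, (i < n)%N -> 0 <= nth 0 c i <= r) ->
  (forall i, (i < n)%N -> R (64 * n + (3 + i))%N = nth 0 c i) ->
  params n L r R -> table_at R (128 * n) (4 * L) (fun _ _ => 1) ->
  wp (While 6 18 coordinate) R (n * (layercost (4 * L) + 3 * L + 17) + 2)
    (fun R' : regfile => [/\ R' 16 = (128 * n + n * ((4 * L).+1 * (4 * L).+1))%:R,
      table_at R' (128 * n + n * ((4 * L).+1 * (4 * L).+1)) (4 * L) (leveltab n L r c n) &
      same_below mainregs (128 * n) R R']).
Proof.
move=> n0 sc L0 r0 cr Rc [[R0 R6 R29 R18] [R9 R10 _ _] [R13 R14 R15 R23] [R16 R17]] Rt.
set D := (4 * L)%N in R13 R14 R15 R23 R17 Rt *.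
set SS := (D.+1 * D.+1)%N.
have low j : (j < 64)%N -> (j < 128 * n)%N by lia.
pose Inv l (R' : regfile) := [/\ R' 18 = (n - l)%:R,
  R' 16 = (128 * n + l * SS)%:R, R' 17 = (128 * n + l * SS + SS)%:R,
  table_at R' (128 * n + l * SS) D (leveltab n L r c l) &
  same_below mainregs (128 * n) R R'].
suff /wp_weaken : wp (While 6 18 coordinate) R (n * (layercost (4 * L) + 3 * L + 17) + 2) (Inv n).
  by apply=> // R' [].
apply: (wp_while (T1 := layercost (4 * L) + 3 * L + 15)).
- by lia.
- move=> l R1 ln [e18 e16 e17 t1 s1].
  split; first by rewrite s1 ?low// R6 e18 ler1n subn_gt0.
  pose i := (n - l.+1)%N; have iN : (i < n)%N by rewrite /i; lia.
  have e2 : (64 * n)%:R + (n - l)%:R + 2%:R = (64 * n + (3 + i))%:R :> rat.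
    by rewrite -!natrD; congr _%:R; rewrite /i; lia.
  apply: (wp_seq (T1 := 5) (T2 := layercost (4 * L) + 3 * L + 10)
    (Q1 := fun R' : regfile => R' 30 = nth 0 c i * (L%:R / r) /\ same [:: 27; 28; 30] R1 R')).
  + by lia.
  + apply: wp_block => //; split; last by rewrite /=; do 5?apply: upd_same.
    pose R1' := exec_block R1 [:: IAdd 27 0 18; IConst 28 2; IAdd 27 27 28].
    rewrite -[exec_block _ _]/(exec_block R1' [:: ILoad 30 27; IMul 30 30 9]).
    have e27 : R1' 27 = (64 * n + (3 + i))%:R.
      by rewrite /R1' /= /upd /= e18 s1 ?low// R0 e2.
    have s1' : same_below mainregs (128 * n) R R1'.
      by rewrite /R1' /=; do 3?[apply: upd_same_below => //].
    clearbody R1'; rewrite /= /upd /= e27 addr_nat s1' ?Rc//.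
    - by rewrite s1' ?low// R9.
    - by lia.
    - by apply: notin_small => //; lia.
  move=> R2 [f30 s2]; have /andP[ci0 cir] := cr _ iN.
  have ciG : 0 <= nth 0 c i * (L%:R / r) by rewrite mulr_ge0// divr_ge0// ltW.
  pose k := nth 0 (gridks L r c) i.
  have ek : k = (Num.truncn (nth 0 c i * (L%:R / r))).+1.
    by rewrite /k (nth_map 0)// sc.
  have sR2 : same_below mainregs (128 * n) R R2.
    by apply: same_below_trans (sameW s2) _ s1.
  apply: (wp_seq (T1 := 3 * L + 6) (T2 := layercost (4 * L) + 4)
    (Q1 := fun R' : regfile => R' 19 = k%:R /\ same [:: 19%N] R2 R')).
  + by lia.
  + have := @wp_floorS 19 30 R2 isT isT; rewrite f30 sR2 ?low//.
    move=> /(_ R6 ciG) /wp_weaken; rewrite -ek; apply=> //.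
    (* The entry is at most [r], so its quotient by the mesh is at most [L], which bounds the
       counting loop. *)
    rewrite leq_add2r leq_mul2l /= -(ler_nat rat).
    have /andP[+ _] := truncn_itv ciG => /le_trans; apply.
    by rewrite mulrCA ler_piMr// ler_pdivrMr// mul1r.
  move=> R3 [f19 s3].
  apply: (wp_seq (T1 := 1) (T2 := layercost (4 * L) + 3)
    (Q1 := fun R' : regfile => R' 19 = (D + k)%:R /\ same [:: 19; 27; 28; 30] R1 R')).
  + by lia.
  + have s3' : same [:: 19; 27; 28; 30] R1 R3.
      by apply: same_trans s3 _ _ => //; apply: same_trans s2 _ _.
    apply: wp_block => //=; split; last by apply: upd_same.
    by rewrite upd_eq f19 s3// sR2 ?low// R13 addrC -natrD.
  move=> R4 [g19 s4].
  have sR4 : same_below mainregs (128 * n) R R4.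
    by apply: same_below_trans (sameW s4) _ s1.
  have B63 : (63 < 128 * n + l * SS)%N by rewrite ltn_addr// low.
  have t4 : table_at R4 (128 * n + l * SS) D (leveltab n L r c l).
    move=> a b aD bD; rewrite s4 ?t1//.
    by apply: notin_small => //; rewrite ltn_addr.
  apply: (wp_seq (T1 := layercost (4 * L)) (T2 := 3)); first by lia.
    apply: (@wp_layer R4 D (128 * n + l * SS) k (r / L%:R) _ B63 _ _ _ _ _ _ _ _ _ t4).
    * by rewrite sR4 ?low.
    * by rewrite sR4 ?low.
    * by rewrite sR4 ?low.
    * by rewrite sR4 ?low.
    * by rewrite sR4 ?low.
    * by rewrite s4.
    * by rewrite s4.
    * by [].
    * by rewrite sR4 ?low.
  rewrite -/SS; move=> R5 [t5 s5].
  have sR5 : same_below mainregs (128 * n) R R5.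
    apply: (@same_below_trans _ layerregs _ _ R4) => // j jn jl.
    by apply: s5 => //; rewrite -addnA ltn_addr.
  have h17 : R5 17 = (128 * n + l * SS + SS)%:R.
    by rewrite s5// ?s4// -addnA ltn_addr// low.
  have h18 : R5 18 = (n - l)%:R.
    by rewrite s5// ?s4// -addnA ltn_addr// low.
  apply: wp_block => //=; split.
  + rewrite /upd /= h18 sR5 ?low// R6.
    by rewrite (_ : n - l = (n - l.+1).+1)%N; [rewrite -natr1 addrK|lia].
  + by rewrite /upd /= h17 sR5 ?low// R29 addr0 (mulSnr l) addnA.
  + by rewrite /upd /= h17 sR5 ?low// R15 -natrD (mulSnr l) !addnA.
  + move=> a b aD bD; rewrite (mulSnr l) (addnA (128 * n)) !upd_neq; try by lia.
    by rewrite t5// leveltabS.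
  + by do 3?[apply: upd_same_below => //].
- by move=> R1 [e18 _ _ _ s]; rewrite s ?low// R6 e18 subnn ler10.
- split=> //.
  + by rewrite subn0.
  + by rewrite mul0n addn0.
  + by rewrite mul0n addn0.
  + move=> a b aD bD; rewrite mul0n addn0 Rt// /leveltab subn0 drop_oversize.
      by rewrite expr0 mul1r.
    by rewrite size_map sc.
Qed.

Definition cost n L :=
  ((9 * n + 18) + ((9 * L + 42) + ((4 * ((4 * L).+1 * (4 * L).+1) + 2)
   + ((n * (layercost (4 * L) + 3 * L + 17) + 2) + 4))))%N.

(** The capped floor is at most [2 L], and the additional [n + 1] at most [2 L]; hence the table
    bound [D = 4 L], which also covers the second radius [L + 2 n]. *)
Lemma gridU_le n L (r : rat) : (0 < L)%N -> (n <= L)%N -> 0 < r ->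
  (gridU n L r <= 4 * L)%N.
Proof.
move=> L0 nL r0; rewrite /gridU; set m := Num.min _ _.
have m0 : 0 <= m by rewrite le_min divr_ge0 ?addr_ge0 ?ler0n// ltW.
have : (Num.truncn m <= L + L)%N.
  rewrite -(ler_nat rat); have /andP[+ _] := truncn_itv m0 => /le_trans; apply.
  by rewrite natrD ge_min lexx orbT.
by lia.
Qed.

Lemma wp_algorithm n delta r (c : seq rat) (R : regfile) (L : nat) :
  gridL n delta = L -> (0 < n)%N -> (n <= L)%N -> 0 < delta -> 0 < r ->
  size c = n -> (forall i, (i < n)%N -> 0 <= nth 0 c i <= r) ->
  R 0 = n%:R -> R 1 = delta -> R 2 = r ->
  (forall i, (i < n)%N -> R (3 + i)%N = nth 0 c i) ->
  wp algorithm R (cost n L)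
    (fun R' : regfile => R' 0 = leveltab n L r c n (gridU n L r) (L + n + n)).
Proof.
move=> eL n0 nL d0 r0 sc cr R0 R1 R2 Rc.
have L0 : (0 < L)%N by rewrite -eL.
apply: (wp_seq (Q1 := relocated n delta r c) (leqnn _)); first exact: wp_relocate.
move=> S1 rel; apply: (wp_seq (leqnn _)); first exact: (wp_setup eL n0 d0 r0 rel).
move=> S2 [par p27 p28 s2]; have [_ _ _ S1c] := rel.
have [[p0 p6 p29 p18] [p9 p10 p11 p12] [p13 p14 p15 p23] [p16 p17]] := par.
have B63 : (63 < 128 * n)%N by lia.
apply: (wp_seq (leqnn _)); first exact: (wp_fill B63 p6 p27 p28).
move=> S3 [t3 s3].
have low j : (j < 64)%N -> (j < 128 * n)%N by lia.
have ncs i : (i < n)%N -> S3 (64 * n + (3 + i))%N = nth 0 c i.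
  move=> iN; rewrite s3; [|by lia|by apply: notin_small => //; lia].
  by rewrite s2 ?S1c//; apply: notin_small => //; lia.
have par3 : params n L r S3.
  by split; split; rewrite s3 ?low.
have T3 : table_at S3 (128 * n) (4 * L) (fun _ _ => 1).
  move=> a b aD bD; apply: t3; nia.
set U := gridU n L r; have UD : (U <= 4 * L)%N by exact: gridU_le.
apply: (wp_seq (leqnn _)); first exact: (wp_main n0 sc L0 r0 cr ncs par3 T3).
move=> S4 [e16 t4 s4]; apply: wp_block => //.
pose S5 := exec_block S4 [:: IMul 27 11 14; IAdd 27 27 12; IAdd 27 27 16].
rewrite -[exec_block _ _]/(exec_block S5 [:: ILoad 0 27]).
have e27 : S5 27 = (128 * n + n * ((4 * L).+1 * (4 * L).+1)
    + (U * (4 * L).+1 + (L + n + n)))%:R.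
  rewrite /S5 /= /upd /= e16 !s4 ?low// !s3 ?low// p11 p14 p12.
  by rewrite -natrM -!natrD addnC.
have s5 : same [:: 27%N] S4 S5 by rewrite /S5 /=; do 3?apply: upd_same.
rewrite /= upd_eq e27 addr_nat s5; last by apply: notin_small => //; lia.
by apply: t4 => //; lia.
Qed.

(** * Accuracy and running time *)

Lemma cost_le : exists K, forall n L, (0 < n)%N -> (n <= L)%N ->
  (cost n L <= K * (n * L ^ 3))%N.
Proof.
(* Every monomial of [cost] is at most [n L^3] for positive [n] and [L], and the coefficients sum to
   [cost 1 1], which is 5489. *)
exists (100 * 55)%N => n L n0 nL; have L0 : (0 < L)%N by exact: leq_trans nL.
have nLL : (0 < n * L * L)%N by rewrite !muln_gt0 n0 L0.
rewrite (_ : L ^ 3 = L * L * L)%N; last by rewrite !expnS expn0 muln1 mulnA.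
have h3 : (n * L * L <= n * L * L * L)%N by rewrite leq_pmulr.
have h2 : (n * L <= n * L * L)%N by rewrite leq_pmulr.
have h1 : (n <= n * L)%N by rewrite leq_pmulr.
have h4 : (L <= n * L)%N by rewrite leq_pmull.
have h5 : (L * L <= n * L * L)%N by rewrite leq_mul2r h4 orbT.
by rewrite /cost /layercost -!mul2n; lia.
Qed.

(** A converse to Bernoulli's inequality: the mixed term [2 n t^2] of [(1 + 2 n t) (1 + t)] is at
    most [t] as long as [2 n t <= 1]. *)
Lemma expr1D_le (F : realFieldType) (t : F) n : 0 <= t -> 2 * n%:R * t <= 1 ->
  (1 + t) ^+ n <= 1 + 2 * n%:R * t.
Proof.
move=> t0; elim: n => [|n IH]; first by rewrite expr0 mulr0 mul0r addr0.
rewrite -natr1 => nt; have n0 : 0 <= n%:R :> F by [].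
have {}IH := IH ltac:(nra).
rewrite exprSr; apply: (@le_trans _ _ ((1 + 2 * n%:R * t) * (1 + t))).
  by apply: ler_wpM2r => //; lra.
nra.
Qed.

Lemma cvol_sandwich {R : realType} (cs : seq R) (ks : seq nat) (h delta r : R)
    (D U W : nat) : let n := size cs in
  (0 < n)%N -> 0 < h -> 0 < delta <= 1 -> 0 < r <= 1 -> grid_approx h cs ks ->
  \sum_(x <- cs) x <= r -> (U <= D)%N ->
  16 * n%:R ^+ 2 * h <= delta * r ->
  Num.min 1 (2 * r) + n%:R * h <= U%:R * h <= Num.min 1 (2 * r) + n.+1%:R * h ->
  W%:R * h = r + 2 * n%:R * h ->
  (cvol cs 1 r <= (h ^+ n * (cnt D ks U W)%:R)%:E <= (1 + delta)%:E * cvol cs 1 r)%E.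
Proof.
move=> n n0 h0 /andP[d0 d1] /andP[r0 r1] csks csr UD hL /andP[U1 U2] eW.
have n1 : 1 <= n%:R :> R by rewrite ler1n.
have sum0 := grid_approx_sum_ge0 csks.
apply/andP; split.
  (* The centre has norm at most [r], so the reach [r] plus that norm is at most [2 r]. *)
  apply: cvol_le_cnt => //; last by rewrite eW.
  apply: le_trans U1; rewrite lerD2r le_min !ge_min lexx /=.
  by apply/orP; right; lra.
(* With [2 n t = delta <= 1], the price [(1 + t)^n] is at most [1 + delta]. *)
pose t := delta / (2 * n%:R).
have ent : 2 * n%:R * t = delta by rewrite /t; field; lra.
have t0 : 0 < t by rewrite divr_gt0// mulr_gt0//; lra.
(* The second radius is the tight one: [2 n h] from [W] and [2 n h] from the lower bound must fit
   into the surplus [t r / 2]. *)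
have hnt : 8 * n%:R * h <= t * r.
  rewrite -(@ler_pM2l _ (2 * n%:R)); last by lra.
  by rewrite [leRHS]mulrA ent; apply: le_trans hL; rewrite expr2; lra.
have nh0 : h <= n%:R * h by rewrite ler_peMl// ltW.
have tr : t * r <= t by rewrite ler_piMr// ltW.
have tsum : t * \sum_(x <- cs) x <= t * r by rewrite ler_wpM2l// ltW.
have minle : Num.min 1 (2 * r) <= 1 by rewrite ge_min lexx.
have low : (((h / (1 + t)) ^+ n * (cnt D ks U W)%:R)%:E <= cvol cs 1 r)%E.
  apply: cnt_le_cvol => //; rewrite -/n; first exact: ltW.
    by rewrite -natr1 in U2; lra.
  by rewrite eW; lra.
have -> : h ^+ n * (cnt D ks U W)%:R =
    (1 + t) ^+ n * ((h / (1 + t)) ^+ n * (cnt D ks U W)%:R).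
  by rewrite mulrA -exprMn mulrCA divff ?mulr1//; lra.
have t1 : (1 + t) ^+ n <= 1 + delta.
  by rewrite -ent; apply: expr1D_le; [exact: ltW|rewrite ent].
rewrite EFinM; apply: (@le_trans _ _ (((1 + t) ^+ n)%:E * cvol cs 1 r)%E).
  by rewrite lee_pmul2l// lte_fin exprn_gt0//; lra.
by rewrite lee_wpmul2r ?lee_fin// cvol_ge0.
Qed.

Lemma gridL_gt n (delta : rat) : 0 < delta ->
  16 * (n%:R * n%:R) < delta * (gridL n delta)%:R.
Proof.
move=> d0; rewrite [ltRHS]mulrC -ltr_pdivrMr//.
have X0 : 0 <= 16 * (n%:R * n%:R) / delta :> rat by rewrite !mulr_ge0// invr_ge0 ltW.
by have /andP[_ lt] := truncn_itv X0; exact: lt.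
Qed.

(** The unit added by rounding is absorbed by [n^2 / delta], which is at least 1; hence 17 instead
    of 16. *)
Lemma gridL_le n (delta : rat) : (0 < n)%N -> 0 < delta < 1 ->
  (gridL n delta)%:R <= 17 * n%:R ^+ 2 / delta.
Proof.
move=> n0 /andP[d0 d1]; have n1 : 1 <= n%:R :> rat by rewrite ler1n.
have X0 : 0 <= 16 * (n%:R * n%:R) / delta :> rat by rewrite !mulr_ge0// invr_ge0 ltW.
have /andP[tX _] := truncn_itv X0.
rewrite /gridL -natr1; apply: le_trans (lerD tX (lexx 1)) _.
rewrite -(ler_pM2r d0) mulrDl !divfK ?gt_eqF// mul1r expr2; nra.
Qed.

Lemma gridL_ge n (delta : rat) : (0 < n)%N -> 0 < delta < 1 -> (n <= gridL n delta)%N.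
Proof.
move=> n0 /andP[d0 d1]; rewrite -(ler_nat rat); have n1 : 1 <= n%:R :> rat by rewrite ler1n.
have := gridL_gt n d0; have : delta * (gridL n delta)%:R <= (gridL n delta)%:R.
  by rewrite ler_piMl// ltW.
nra.
Qed.

(** The floor plus one differs from [x / h] by at most 1, that is, by at most one mesh after
    scaling. *)
Lemma gridks_approx {R : realType} (L : nat) (r : rat) (c : seq rat) :
  (0 < L)%N -> 0 < r -> all (>= 0) c ->
  grid_approx (ratr (r / L%:R)) [seq (ratr x : R) | x <- c] (gridks L r c).
Proof.
move=> L0 r0; have L0' : 0 < L%:R :> rat by rewrite ltr0n.
elim: c => //= x c IH /andP[x0 /IH ->]; rewrite andbT ler0q x0 /=.
apply/asboolP; rewrite /near_grid -[_.+1%:R](ratr_nat R) -rmorphM -rmorphB -ratr_norm ler_rat.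
have h0 : 0 < r / L%:R by rewrite divr_gt0.
have X0 : 0 <= x * (L%:R / r) by rewrite mulr_ge0// divr_ge0// ltW.
have /andP[k1 k2] := truncn_itv X0; set k := Num.truncn _ in k1 k2 *.
have ex : x = x * (L%:R / r) * (r / L%:R) by field; rewrite !gt_eqF.
rewrite {1}ex -mulrBl normrM (gtr0_norm h0); apply: ler_piMl; first exact: ltW.
by rewrite ler_norml; rewrite -natr1 in k2 *; lra.
Qed.

Lemma gridU_itv n L (r : rat) : (0 < L)%N -> 0 < r ->
  Num.min 1 (2 * r) + n%:R * (r / L%:R) <= (gridU n L r)%:R * (r / L%:R)
    <= Num.min 1 (2 * r) + n.+1%:R * (r / L%:R).
Proof.
move=> L0 r0; have L0' : 0 < L%:R :> rat by rewrite ltr0n.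
have h0 : 0 < r / L%:R by rewrite divr_gt0.
have -> : Num.min 1 (2 * r) = Num.min (L%:R / r) (L%:R + L%:R) * (r / L%:R).
  rewrite minr_pMl ?(ltW h0)//; congr Num.min.
    by field; rewrite !gt_eqF.
  by field; rewrite gt_eqF.
rewrite -!mulrDl !ler_pM2r// /gridU.
have m0 : 0 <= Num.min (L%:R / r) (L%:R + L%:R) :> rat.
  by rewrite le_min divr_ge0 ?addr_ge0 ?ler0n// ltW.
have /andP[t1 t2] := truncn_itv m0.
by rewrite natrD -!natr1 in t2 *; lra.
Qed.

(** All quantities of the program are rational, so the numerical hypotheses of [cvol_sandwich] are
    checked in [rat] and transported along [ratr]. *)
Lemma leveltab_sandwich {R : realType} (n : nat) (delta r : rat) (c : seq rat) :
  let L := gridL n delta in let cs := [seq (ratr x : R) | x <- c] in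
  (0 < n)%N -> size c = n -> 0 < delta < 1 -> 0 < r <= 1 -> all (>= 0) c ->
  \sum_(x <- c) x <= r ->
  (cvol cs 1 (ratr r) <= (ratr (leveltab n L r c n (gridU n L r) (L + n + n)))%:E
    <= (1 + ratr delta)%:E * cvol cs 1 (ratr r))%E.
Proof.
move=> L cs n0 sc d01 /andP[r0 r1] c0 cr; have /andP[d0 d1] := d01.
have L0 : (0 < L)%N by []; have L0' : 0 < L%:R :> rat by rewrite ltr0n.
have scs : size cs = n by rewrite size_map.
have nL : (n <= L)%N by exact: gridL_ge.
have two : (2 : R) = ratr 2 by rewrite ratr_nat.
have emin : Num.min 1 (2 * ratr r) = ratr (Num.min 1 (2 * r)) :> R.
  by rewrite minr_rat rmorph1 two; congr Num.min; rewrite -rmorphM.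
have -> : ratr (leveltab n L r c n (gridU n L r) (L + n + n)) =
   ratr (r / L%:R) ^+ size cs * (cnt (4 * L) (gridks L r c) (gridU n L r) (L + n + n))%:R :> R.
  by rewrite /leveltab subnn drop0 [LHS]rmorphM /= rmorphXn ratr_nat scs.
have /andP[U1 U2] := gridU_itv n L0 r0.
apply: cvol_sandwich; rewrite ?scs//.
- by rewrite ltr0q divr_gt0.
- by rewrite ltr0q d0 /= -(rmorph1 (@ratr R)) ler_rat ltW.
- by rewrite ltr0q r0 /= -(rmorph1 (@ratr R)) ler_rat.
- exact: gridks_approx.
- by rewrite big_map -rmorph_sum ler_rat.
- exact: gridU_le.
- rewrite -[16](ratr_nat R) -[n%:R](ratr_nat R) -rmorphXn -!rmorphM ler_rat.
  rewrite mulrA ler_pdivrMr// [leRHS]mulrAC ler_pM2r// expr2.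
  by apply: ltW; exact: gridL_gt.
- rewrite emin -(ratr_nat R n) -(ratr_nat R n.+1) -(ratr_nat R (gridU _ _ _)).
  by rewrite -!rmorphM -!rmorphD !ler_rat U1.
- rewrite two -(ratr_nat R n) -(ratr_nat R (L + n + n)) -!rmorphM -rmorphD.
  by congr ratr; rewrite !natrD; field; rewrite gt_eqF.
Qed.

Lemma wp_compile (c : cmd) (s : ram_state) T (Q : regfile -> Prop) :
  pc s = 0%N -> wp c (regs s) T Q ->
  exists k, [/\ (k <= T)%N, halted (compile 0 c) (run (compile 0 c) k s) &
    Q (regs (run (compile 0 c) k s))].
Proof.
case: s => _ R /= -> [R' [k [e kT q]]]; exists k.
have code : code_at (compile 0 c) 0 (compile 0 c) by exists [::], [::]; rewrite cats0.
(* The run stops just past the code, where the default instruction [IHalt] is read. *)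
by rewrite (run_ev e code) /halted /cur_instr nth_default// size_compile.
Qed.

Lemma cost_gridL_le : exists K : rat, forall n (delta : rat), (0 < n)%N ->
  0 < delta < 1 -> (cost n (gridL n delta))%:R <= K * n%:R ^+ 7 / delta ^+ 3.
Proof.
have [k costK] := cost_le; set K : rat := k%:R; have K0 : 0 <= K by exact: ler0n.
exists (K * 17 ^+ 3) => n delta n0 d01; have /andP[d0 d1] := d01.
have /(costK _ _ n0) := gridL_ge n0 d01; rewrite -(ler_nat rat) => /le_trans; apply.
rewrite natrM [(n * _)%:R]natrM natrX -/K; set m : rat := n%:R.
have m0 : 0 <= m by exact: ler0n.
(* Inserting [L <= 17 n^2 / delta] into [n L^3] yields the exponents 7 and 3. *)
have -> : K * 17 ^+ 3 * m ^+ 7 / delta ^+ 3 = K * (m * (17 * m ^+ 2 / delta) ^+ 3).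
  by field; rewrite gt_eqF.
apply: (ler_wpM2l K0); apply: (ler_wpM2l m0).
apply: (@lerXn2r _ 3); rewrite ?nnegrE; [exact: ler0n| |exact: gridL_le].
by rewrite !mulr_ge0 ?exprn_ge0// invr_ge0 ltW.
Qed.

Theorem mainTheorem14 :
  exists (p : program) (K : rat),
    forall (n : nat) (delta : rat) (c : n.-tuple rat) (r : rat),
      (0 < n)%N -> 0 < delta < 1 ->
      (forall i : 'I_n, 0 <= tnth c i) ->
      0 < r <= 1 -> \sum_(i < n) `|tnth c i| <= r ->
      exists k : nat,
        [/\ halted p (run p k (init_state n delta r c)),
            k%:R <= K * n%:R ^+ 7 / delta ^+ 3 &
            forall R : realType,
              let V := @vol R n (@cross R n (nseq n 0) 1 `&`
                                 @cross R n [seq ratr x | x <- c] (ratr r)) in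
              let Z := ((ratr (output (run p k (init_state n delta r c))) : R)%:E) in
              (V <= Z <= (1 + ratr delta)%:E * V)%E].
Proof.
have [K costK] := cost_gridL_le; exists (compile 0 algorithm), K.
move=> n delta c r n0 d01 c0 r01 cr; have /andP[d0 d1] := d01; have /andP[r0 r1] := r01.
set L := gridL n delta; have nL : (n <= L)%N by exact: gridL_ge.
have c0' i : (i < n)%N -> 0 <= nth 0 c i.
  by move=> iN; have := c0 (Ordinal iN); rewrite (tnth_nth 0).
have sum_c : \sum_(x <- c) x <= r.
  by apply: le_trans cr; rewrite big_tuple; apply: ler_sum => i _; exact: ler_norm.
have c_itv i : (i < n)%N -> 0 <= nth 0 c i <= r.
  move=> iN; rewrite c0'//=; apply: le_trans cr.
  rewrite (bigD1 (Ordinal iN))//= (tnth_nth 0) /=.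
  by apply: ler_wpDr; [exact: sumr_ge0|exact: ler_norm].
have all0 : all (>= 0) c.
  by apply/(all_nthP 0) => i; rewrite size_tuple => /c0'.
pose R0 := regs (init_state n delta r c).
have R0c i : (i < n)%N -> R0 (3 + i)%N = nth 0 c i.
  by move=> iN; rewrite /R0 /=; case: ifP => [_|/negbT]; [rewrite addKn|lia].
have := wp_algorithm (erefl L) n0 nL d0 r0 (size_tuple c) c_itv
  (erefl _ : R0 0 = n%:R) (erefl _ : R0 1 = delta) (erefl _ : R0 2 = r) R0c.
move=> /(@wp_compile _ (init_state n delta r c) _ _ (erefl _)) [k].
move: (compile 0 algorithm) => p [kT hk out]; exists k; split; first exact: hk.
  by apply: le_trans (costK _ _ n0 d01); rewrite ler_nat.
move=> R; cbv zeta; rewrite /output out.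
have := @vol_cross R [seq ratr x | x <- c] 1 (ratr r).
rewrite size_map size_tuple => ->.
by apply: leveltab_sandwich; rewrite ?size_tuple.
Qed.
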